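(* Let $\boldsymbol\alpha$ be a sequence compactly included in $\mathbb D$ (i.e. $\sup_n|\alpha_n|<1$), $\mu$ a measure on $\mathbb T$ and $\boldsymbol a=\mathcal S_{\boldsymbol\alpha}(\mu)$. Then the ORF $(\chi_n)_{n\ge0}$ associated with $(\alpha_1,\hat\alpha_2,\alpha_3,\hat\alpha_4,\dots)$ are a basis of $L^2_\mu$, and the matrix of $T_\mu$ with respect to $(\chi_n)_{n\ge0}$ is $$\mathcal U=\tilde\zeta_{\mathcal A}(\mathcal C),\qquad \mathcal A=\mathcal A(\boldsymbol\alpha),\quad \mathcal C=\mathcal C(\boldsymbol a).$$
   Context: $\mathbb T$ is the unit circle, $\mathbb D$ the open unit disk. A measure on $\mathbb T$ is a probability Borel measure $\mu$ on $\mathbb T$ with infinite support. $L^2_\mu$ carries the inner product $\langle f,g\rangle_\mu=\int\overline{f}\,g\,d\mu$, and $T_\mu$ is the unitary operator $f(z)\mapsto zf(z)$ on $L^2_\mu$. ORF. Let $\boldsymbol\alpha=(\alpha_n)_{n\ge1}$ be a sequence in $\mathbb D$ and set $\alpha_0=0$. For $n\ge0$ let $\varpi_n(z)=1-\overline{\alpha_n}z$, $\varpi_n^*(z)=z-\alpha_n$, $\zeta_n=\varpi_n^*/\varpi_n$. Let $B_0=1$, $B_n=\zeta_1\cdots\zeta_n$, $f_*(z)=\overline{f(1/\overline z)}$ and $\hat z=1/\overline z$ (with $\hat 0=\infty$). The orthogonal rational functions (ORF) $(\phi_n)_{n\ge0}$ of $\mu$ associated with $\boldsymbol\alpha$ are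 the result of orthonormalizing $(B_n)_{n\ge0}$ in $L^2_\mu$ (so $\phi_0,\dots,\phi_n$ is an orthonormal basis of $\operatorname{span}\{B_0,\dots,B_n\}$ for every $n$), with unimodular factors chosen so that $\phi_0=1$ and, with $\phi_n^*=B_n\phi_{n*}$, $$\begin{pmatrix}\phi_n\\ \phi_n^*\end{pmatrix}=e_n\frac{\varpi_{n-1}}{\varpi_n}\begin{pmatrix}1&a_n\\ \overline{a_n}&1\end{pmatrix}\begin{pmatrix}\zeta_{n-1}\phi_{n-1}\\ \phi_{n-1}^*\end{pmatrix},\quad e_n=\sqrt{\frac{\varpi_n(\alpha_n)}{\varpi_{n-1}(\alpha_{n-1})}\frac1{1-|a_n|^2}},\quad n\ge1,$$ for some $a_n\in\mathbb D$. This normalization exists and both $(\phi_n)$ and $\boldsymbol a=(a_n)_{n\ge1}$ are then uniquely determined; one writes $\boldsymbol a=\mathcal S_{\boldsymbol\alpha}(\mu)$. Put $B_0^e=1$ and $B_n^e=\zeta_2\zeta_4\cdots\zeta_{2n}$. The ORF $(\chi_n)_{n\ge0}$ associated with $(\alpha_1,\hat\alpha_2,\alpha_3,\hat\alpha_4,\dots)$ are $$\chi_{2n}=B^e_{n*}\phi_{2n}^*,\qquad \chi_{2n+1}=B^e_{n*}\phi_{2n+1},\qquad n\ge0;$$ they form an orthonormal sequence in $L^2_\mu$. ''Basis'' means orthonormal basis of the Hilbert space. Matrices. The matrix of an operator $T$ with respect to an orthonormal basis $(f_n)$ has entries $\langle f_i,Tf_j\rangle_\mu$; infinite bounded matrices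 are identified with operators on $\ell^2$. $\mathcal A(\boldsymbol\alpha)=\operatorname{diag}(\alpha_0,\alpha_1,\alpha_2,\dots)$. With $\rho_n=\sqrt{1-|a_n|^2}$ and $\Theta_n=\begin{pmatrix}-a_n&\rho_n\\ \rho_n&\overline{a_n}\end{pmatrix}$, $\mathcal C(\boldsymbol a)=\mathcal C_o\mathcal C_e$ is the five-diagonal unitary matrix with $\mathcal C_o=\Theta_1\oplus\Theta_3\oplus\Theta_5\oplus\cdots$ and $\mathcal C_e=1\oplus\Theta_2\oplus\Theta_4\oplus\cdots$ (here $1$ is a $1\times1$ block). Operator Möbius transformation. For bounded operators $A,T$ on a Hilbert space with $\|A\|<1$, $\|T\|\le1$, set $\eta_A=\sqrt{1-AA^\dag}$ and $\tilde\zeta_A(T)=\eta_A^{-1}(T+A)(1+A^\dag T)^{-1}\eta_{A^\dag}$. *)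

(* Defs.v *)
From HB Require Import structures.
From mathcomp Require Import all_boot all_order all_algebra complex.
From mathcomp Require Import all_classical all_reals all_analysis.
From mathcomp Require Import ring.

Set Implicit Arguments.
Unset Strict Implicit.
Unset Printing Implicit Defensive.
Import Order.TTheory GRing.Theory Num.Theory.
Import numFieldNormedType.Exports.
Local Open Scope classical_set_scope.
Local Open Scope ring_scope.

(* The norm of R[i] takes its values in R[i]; this is the same number in R. *)
Definition cmod (R : realType) (z : R[i]) : R := complex.Re `|z|.

Definition csum (R : realType) (u : nat -> R[i]) : R[i] :=
  Complex (limn (series (fun n => complex.Re (u n))))
          (limn (series (fun n => complex.Im (u n)))).

(* Operators on a complex inner product space (H, ip); ip is linear in its
   second argument. Notions which are partial functions of an operator
   (adjoint, inverse, positive square root) are given by their graphs. *)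
Section Operators.
Context {R : realType} {H : lmodType R[i]} (ip : H -> H -> R[i]).

Definition hnorm (x : H) : R := Num.sqrt (complex.Re (ip x x)).

Definition opnorm (T : H -> H) : \bar R :=
  ereal_sup [set (hnorm (T x))%:E | x in [set x | hnorm x <= 1]].

Definition bounded_op (T : H -> H) : Prop := linear T /\ (opnorm T < +oo)%E.

Definition is_adjoint (T T' : H -> H) : Prop :=
  bounded_op T' /\ forall x y, ip (T' x) y = ip x (T y).

Definition is_inverse (T S : H -> H) : Prop :=
  [/\ bounded_op S, cancel T S & cancel S T].

Definition is_sqrt (P S : H -> H) : Prop :=
  [/\ bounded_op S, (forall x, 0 <= ip x (S x)) & S \o S =1 P].

(* is_moebius A T V : V is the operator Moebius transform of T, namely
   eta_A^-1 (T + A) (1 + A^dag T)^-1 eta_{A^dag}. *)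
Definition is_moebius (A T V : H -> H) : Prop :=
  [/\ bounded_op A, (opnorm A < 1)%E, bounded_op T, (opnorm T <= 1)%E &
  exists Ad etaA etaAd etaAinv W : H -> H,
  [/\ is_adjoint A Ad,
      is_sqrt (fun x => x - A (Ad x)) etaA /\
      is_sqrt (fun x => x - Ad (A x)) etaAd,
      is_inverse etaA etaAinv,
      is_inverse (fun x => x + Ad (T x)) W &
      forall x, V x = etaAinv ((fun y => T y + A y) (W (etaAd x)))]].

End Operators.

Definition orthonormal (R : realType) (H : Type) (ip : H -> H -> R[i])
  (f : nat -> H) : Prop := forall i j, ip (f i) (f j) = (i == j)%:R.

Definition op_matrix (R : realType) (H : Type) (ip : H -> H -> R[i])
  (f : nat -> H) (T : H -> H) : nat -> nat -> R[i] :=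
  fun i j => ip (f i) (T (f j)).

Section Ell2.
Context {R : realType}.

Definition l2sum (x : nat -> R[i]) : \bar R :=
  (\sum_(0 <= n <oo) (cmod (x n) ^+ 2)%:E)%E.

Definition l2pred : {pred (nat -> R[i])} :=
  fun x : nat -> R[i] => (l2sum x < +oo)%E.

Record ell2 : Type := Ell2 {
  ell2_val :> nat -> R[i];
  ell2_summable : ell2_val \in l2pred }.

HB.instance Definition _ := [isSub for ell2_val].
HB.instance Definition _ := [Choice of ell2 by <:].

Lemma cmodE (z : R[i]) : `|z| = (cmod z)%:C%C.
Proof. by rewrite /cmod normc_def. Qed.

Lemma cmod_ge0 (z : R[i]) : 0 <= cmod z.
Proof. by rewrite -lecR -cmodE normr_ge0. Qed.

Lemma cmodD (z w : R[i]) : cmod (z + w) <= cmod z + cmod w.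
Proof. by rewrite -lecR rmorphD /= -!cmodE ler_normD. Qed.

Lemma cmodM (z w : R[i]) : cmod (z * w) = cmod z * cmod w.
Proof.
by apply: (@complexI R); rewrite rmorphM /= -!cmodE normrM.
Qed.

Lemma l2pred_closed : submod_closed l2pred.
Proof.
have sq0 (z : R[i]) : (0 <= (cmod z ^+ 2)%:E)%E by rewrite lee_fin sqr_ge0.
split.
  rewrite unfold_in /l2sum eseries0 ?ltry// => n _ _.
  by rewrite /cmod normr0 expr0n.
move=> a x y; rewrite !unfold_in /l2sum => xoo yoo.
have le1 : (\sum_(0 <= n <oo) (cmod ((a *: x + y)%R n) ^+ 2)%:E <=
    \sum_(0 <= n <oo) ((2 * cmod a ^+ 2)%:E * (cmod (x n) ^+ 2)%:E +
      2%:E * (cmod (y n) ^+ 2)%:E))%E.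
  apply: lee_nneseries => n _ *; first exact: sq0.
  rewrite -!EFinM -EFinD lee_fin.
  have h : cmod (a * x n + y n) <= cmod a * cmod (x n) + cmod (y n).
    by rewrite -cmodM cmodD.
  apply: (@le_trans _ _ ((cmod a * cmod (x n) + cmod (y n)) ^+ 2)).
    rewrite ler_pXn2r// nnegrE ?cmod_ge0//.
    by rewrite addr_ge0 ?mulr_ge0 ?cmod_ge0.
  rewrite -subr_ge0 [leRHS](_ : _ = (cmod a * cmod (x n) - cmod (y n)) ^+ 2).
    exact: sqr_ge0.
  by ring.
have c0 : (0 <= 2 * cmod a ^+ 2)%R by rewrite mulr_ge0 ?sqr_ge0.
apply: (le_lt_trans le1); rewrite nneseriesD.
- rewrite !nneseriesZl//.
  + by rewrite lte_add_pinfty// lte_mul_pinfty// ?lee_fin.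
- by move=> *; rewrite mule_ge0.
- by move=> *; rewrite mule_ge0.
Qed.

HB.instance Definition _ := GRing.isSubmodClosed.Build _ _ l2pred l2pred_closed.
HB.instance Definition _ := [SubChoice_isSubLmodule of ell2 by <:].

Definition l2dot (x y : ell2) : R[i] := csum (fun n => (x n)^* * y n).

Lemma l2unit_summable (n : nat) : (fun k => (k == n)%:R : R[i]) \in l2pred.
Proof.
rewrite unfold_in /l2sum (nneseries_split 0 n.+1); last first.
  by move=> k _; rewrite lee_fin sqr_ge0.
rewrite add0n [X in (_ + X)%E]eseries0 ?adde0 ?sumEFin ?ltry// => k nk _.
by rewrite gtn_eqF// /cmod normr0 expr0n.
Qed.

Definition l2unit (n : nat) : ell2 := Ell2 (l2unit_summable n).

End Ell2.
Arguments ell2 : clear implicits.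

Definition is_operator_of (R : realType) (M : nat -> nat -> R[i])
    (T : ell2 R -> ell2 R) : Prop :=
  bounded_op l2dot T /\ op_matrix l2dot l2unit T = M.

Section Matrices.
Context {R : realType}.
Implicit Types (alpha a : nat -> R[i]) (M N : nat -> nat -> R[i]).

(* csum is a genuine sum here for bounded M and N: rows and columns are in
   l^2. *)
Definition mx_mul M N : nat -> nat -> R[i] :=
  fun i j => csum (fun k => M i k * N k j).

Definition mx_diag alpha : nat -> nat -> R[i] :=
  fun i j => if i == j then alpha i else 0.

(* Entries of T 0 (+) T 1 (+) ..., block T k occupying the rows 2k, 2k+1. *)
Definition mx_blocks (T : nat -> 'M[R[i]]_2) : nat -> nat -> R[i] :=
  fun i j => if i./2 == j./2 then T i./2 (inord (odd i)) (inord (odd j)) else 0.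

(* Entries of 1 (+) M, where 1 is a 1 x 1 block. *)
Definition mx_one_plus M : nat -> nat -> R[i] := fun i j =>
  match i, j with
  | 0, 0 => 1
  | i'.+1, j'.+1 => M i' j'
  | _, _ => 0
  end.

Definition rho a n : R[i] := sqrtC (1 - `|a n| ^+ 2).

Definition Theta a n : 'M[R[i]]_2 := \matrix_(p < 2, q < 2)
  if p == q then (if p == ord0 then - a n else (a n)^* ) else rho a n.

Definition cmv_o a := mx_blocks (fun k => Theta a k.*2.+1).
Definition cmv_e a := mx_one_plus (mx_blocks (fun k => Theta a k.*2.+2)).
Definition cmv a := mx_mul (cmv_o a) (cmv_e a).

End Matrices.

Definition circle (R : realType) : Type := set_type [set z : R[i]^o | `|z| = 1].

Lemma circle1_subproof (R : realType) :
  (1 : R[i]) \in [set z : R[i]^o | `|z| = 1].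
Proof. by rewrite inE /= normr1. Qed.

HB.instance Definition _ (R : realType) := Topological.on (circle R).
HB.instance Definition _ (R : realType) :=
  isPointed.Build (circle R) (exist _ (1 : R[i]) (circle1_subproof R)).

Definition circle_borel (R : realType) :=
  g_sigma_algebraType (@open (circle R)).

Definition circle_val (R : realType) (z : circle R) : R[i] := set_val z.

Section L2.
Context {R : realType} (mu : probability (circle_borel R) R).
Implicit Types f g : circle R -> R[i].

Definition supp : set (circle R) :=
  [set z | forall U : set (circle R), open U -> U z -> (0 < mu U)%E].

Definition cintegral f : R[i] :=
  Complex (\int[mu]_z complex.Re (f z)) (\int[mu]_z complex.Im (f z)).

Definition L2dot f g : R[i] := cintegral (fun z => (f z)^* * g z).

Definition L2norm f : R := Num.sqrt (complex.Re (L2dot f f)).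

(* Functions, not classes modulo a.e. equality, represent the elements of
   L^2_mu. *)
Definition L2 : set (circle R -> R[i]) := [set f |
  [/\ measurable_fun [set: circle_borel R] (fun z => complex.Re (f z)),
      measurable_fun [set: circle_borel R] (fun z => complex.Im (f z)) &
      (\int[mu]_z (cmod (f z) ^+ 2)%:E < +oo)%E]].

Definition is_L2_basis (f : nat -> circle R -> R[i]) : Prop :=
  [/\ forall n, L2 (f n),
      orthonormal L2dot f &
      forall g, L2 g -> forall e : R, 0 < e ->
        exists n (c : nat -> R[i]),
          L2norm (fun z => g z - \sum_(k < n) c k * f k z) < e].

Definition mul_z f : circle R -> R[i] := fun z => circle_val z * f z.

End L2.

(* A rational function is represented by a function on R[i]; its values at its
   poles (and, for reflected functions, at 0) are irrelevant, and all rational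
   functions below have no pole on the circle, on which they are compared. *)
Section ORF.
Context {R : realType}.
Implicit Types (alpha a : nat -> R[i]) (f : R[i] -> R[i])
  (phi : nat -> R[i] -> R[i]).

Definition varpi alpha n (z : R[i]) : R[i] := 1 - (alpha n)^* * z.
Definition varpi_star alpha n (z : R[i]) : R[i] := z - alpha n.
Definition zeta alpha n (z : R[i]) : R[i] := varpi_star alpha n z / varpi alpha n z.
Definition blaschke alpha n (z : R[i]) : R[i] :=
  \prod_(1 <= k < n.+1) zeta alpha k z.
Definition reflect_c f (z : R[i]) : R[i] := (f (1 / z^* ))^*.

Definition phi_star alpha phi n (z : R[i]) : R[i] :=
  blaschke alpha n z * reflect_c (phi n) z.

Definition orf_e alpha a n : R[i] :=
  sqrtC (varpi alpha n (alpha n) / varpi alpha n.-1 (alpha n.-1)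
         * (1 / (1 - `|a n| ^+ 2))).

Definition in_span (f : R[i] -> R[i]) (g : nat -> R[i] -> R[i]) n : Prop :=
  exists c : nat -> R[i], forall z, f z = \sum_(k < n.+1) c k * g k z.

(* phi is the sequence of ORF of mu associated with (alpha_n), n >= 1, and
   a = S_alpha(mu); alpha 0 is the auxiliary value alpha_0 and a 0 is unused. *)
Definition is_orf (mu : probability (circle_borel R) R) alpha phi a : Prop :=
  [/\ forall n, in_span (phi n) (blaschke alpha) n /\
                in_span (blaschke alpha n) phi n,
      orthonormal (L2dot mu) (fun n z => phi n (circle_val z)),
      forall z, phi 0 z = 1,
      forall n, (0 < n)%N -> `|a n| < 1 &
      forall n (x : circle R), (0 < n)%N -> let z := circle_val x in
        let r := orf_e alpha a n * (varpi alpha n.-1 z / varpi alpha n z) in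
        phi n z = r * (zeta alpha n.-1 z * phi n.-1 z
                       + a n * phi_star alpha phi n.-1 z) /\
        phi_star alpha phi n z = r * ((a n)^* * (zeta alpha n.-1 z * phi n.-1 z)
                                      + phi_star alpha phi n.-1 z)].

Definition blaschke_even alpha n (z : R[i]) : R[i] :=
  \prod_(1 <= k < n.+1) zeta alpha k.*2 z.

(* The ORF associated with (alpha_1, ^alpha_2, alpha_3, ^alpha_4, ...). *)
Definition chi alpha phi n : circle R -> R[i] := fun x =>
  let z := circle_val x in
  reflect_c (blaschke_even alpha n./2) z *
  (if odd n then phi n z else phi_star alpha phi n z).

End ORF.

(* Main.v *)
(* Multiplied by the conjugate of the even Blaschke product, the recurrence of
   the ORF becomes z chi eta^-1 (1 + A^dag C) = chi eta^-1 (C + A), where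
   eta = (1 - A A^dag)^1/2 is diagonal. As |A| < 1 and C is unitary, 1 + A^dag C
   and C + A are invertible on ell2. Truncating the solution x of
   (1 + A^dag C) x = eta e_j yields finite combinations of the chi_i which
   converge to z chi_j and whose coefficients converge to the j-th column of the
   Moebius transform; this gives the matrix entries, and shows that the closed
   span K of the chi_i is invariant under z. Solving (C + A) x = eta e_j instead
   shows that K is invariant under 1/z. The bounded functions m with m K
   contained in K therefore form an algebra which contains Re z and Im z and is
   closed under bounded pointwise limits, hence contains the indicators of all
   Borel sets; since chi_0 = 1, K is the whole of L^2. Orthonormality of the
   chi_i only needs that phi_n is orthogonal to the span L_(n-1) of
   B_0, ..., B_(n-1), and that zeta_n L_m is contained in L_n for m < n. *)

Require Import Defs.
From HB Require Import structures.
From mathcomp Require Import all_boot all_order all_algebra complex.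
From mathcomp Require Import all_classical all_reals all_analysis.
From mathcomp Require Import measurable_realfun ring lra.

Set Implicit Arguments.
Unset Strict Implicit.
Unset Printing Implicit Defensive.
Import Order.TTheory GRing.Theory Num.Theory.
Import numFieldNormedType.Exports.
Local Open Scope classical_set_scope.
Local Open Scope ring_scope.

(** * Complex numbers and complex series *)

(** Elements of L^2 are functions, not classes, and infinite combinations of the [chi_i] are never
    formed: every limit is a finite combination within a given error. Errors are measured by squared
    norms, so that the triangle inequality becomes a convexity inequality summed term by term. The
    matrices of A, C, eta and of their adjoints are row-finite; a fixed coordinate of such an
    operator applied to a truncation is therefore eventually exact.

    C arises by solving the recurrence for other unknowns: the step from n to n + 1, a hyperbolic
    transfer matrix, becomes the unitary [Theta_(n+1)] once an old and a new function are exchanged.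
    Odd steps leave the even Blaschke product unchanged and assemble to [C_o]; even steps bring in
    the conjugate of [zeta_2k], which swaps [varpi^*] and [varpi], and assemble to [C_e]. This
    relates row vectors; symmetry of [Theta] moves it to columns.

    Invariance of K under z alone could not give density: for Lebesgue measure the Hardy space
    contains 1 and is invariant under z. Hence the second equation, with C + A. *)

Section Modulus.
Context {R : realType}.
Implicit Types z w : R[i].

Lemma cmod_sqr z : cmod z ^+ 2 = complex.Re z ^+ 2 + complex.Im z ^+ 2.
Proof.
by case: z => x y; rewrite /cmod /= sqr_sqrtr// addr_ge0 ?sqr_ge0.
Qed.

Lemma cmod_sqrE z : z^* * z = (cmod z ^+ 2)%:C%C.
Proof. by rewrite mulrC -normCK cmodE rmorphXn. Qed.

Lemma cmod0 : cmod (0 : R[i]) = 0.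
Proof. by rewrite /cmod normr0. Qed.

Lemma cmod1 : cmod (1 : R[i]) = 1.
Proof. by rewrite /cmod normr1. Qed.

Lemma cmodN z : cmod (- z) = cmod z.
Proof. by rewrite /cmod normrN. Qed.

Lemma cmod_conj z : cmod z^* = cmod z.
Proof. by rewrite /cmod norm_conjC. Qed.

Lemma cmod_sqr_eq0 z : cmod z ^+ 2 = 0 -> z = 0.
Proof.
move=> /eqP; rewrite expf_eq0/= => /eqP z0.
by apply/eqP; rewrite -normr_eq0 cmodE z0.
Qed.

(* Convexity of the square, with weights [1 - t] and [t]. *)
Lemma cmod_sqrD (t : R) z w : 0 < t < 1 ->
  cmod (z + w) ^+ 2 <= cmod z ^+ 2 / (1 - t) + cmod w ^+ 2 / t.
Proof.
case/andP=> t0 t1; have t1' : 0 < 1 - t by rewrite subr_gt0.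
apply: (@le_trans _ _ ((cmod z + cmod w) ^+ 2)).
  by rewrite ler_sqr ?cmodD// nnegrE ?addr_ge0 ?cmod_ge0.
rewrite -subr_ge0.
rewrite [leRHS](_ : _ = (t * cmod z - (1 - t) * cmod w) ^+ 2 / (t * (1 - t))).
  by rewrite divr_ge0 ?sqr_ge0// mulr_ge0 ?ltW.
by field; rewrite !gt_eqF.
Qed.

Lemma cmod_sqrD2 z w : cmod (z + w) ^+ 2 <= 2 * (cmod z ^+ 2 + cmod w ^+ 2).
Proof.
have := @cmod_sqrD 2^-1 z w; rewrite invr_gt0 ltr0n invf_lt1 ?ltr1n ?ltr0n//.
move=> /(_ isT) /le_trans; apply.
by rewrite le_eqVlt; apply/orP; left; apply/eqP; field.
Qed.

Lemma Re_sum (I : Type) (r : seq I) (P : pred I) (F : I -> R[i]) :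
  complex.Re (\sum_(i <- r | P i) F i) = \sum_(i <- r | P i) complex.Re (F i).
Proof. exact: raddf_sum. Qed.

Lemma Im_sum (I : Type) (r : seq I) (P : pred I) (F : I -> R[i]) :
  complex.Im (\sum_(i <- r | P i) F i) = \sum_(i <- r | P i) complex.Im (F i).
Proof. exact: raddf_sum. Qed.

Lemma ReM z w : complex.Re (z * w) =
  complex.Re z * complex.Re w - complex.Im z * complex.Im w.
Proof. by case: z w => [a b] [c d]. Qed.

Lemma ImM z w : complex.Im (z * w) =
  complex.Re z * complex.Im w + complex.Im z * complex.Re w.
Proof. by case: z w => [a b] [c d]. Qed.

Lemma complex_ext z w :
  complex.Re z = complex.Re w -> complex.Im z = complex.Im w -> z = w.
Proof. by case: z w => [a b] [c d] /= -> ->. Qed.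

Lemma ReJ z : complex.Re z^* = complex.Re z. Proof. by case: z. Qed.

Lemma ImJ z : complex.Im z^* = - complex.Im z. Proof. by case: z. Qed.

Lemma ReD z w : complex.Re (z + w) = complex.Re z + complex.Re w.
Proof. by case: z w => [a b] [c d]. Qed.

Lemma ImD z w : complex.Im (z + w) = complex.Im z + complex.Im w.
Proof. by case: z w => [a b] [c d]. Qed.

Lemma ReN z : complex.Re (- z) = - complex.Re z. Proof. by case: z. Qed.

Lemma ImN z : complex.Im (- z) = - complex.Im z. Proof. by case: z. Qed.

Lemma Re_le_cmod z : `|complex.Re z| <= cmod z.
Proof.
rewrite -ler_sqr ?nnegrE ?cmod_ge0// cmod_sqr real_normK ?num_real//.
by rewrite lerDl sqr_ge0.
Qed.

Lemma Im_le_cmod z : `|complex.Im z| <= cmod z.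
Proof.
rewrite -ler_sqr ?nnegrE ?cmod_ge0// cmod_sqr real_normK ?num_real//.
by rewrite lerDr sqr_ge0.
Qed.

End Modulus.

Section ComplexSequences.
Context {R : realType}.
Implicit Types u v : nat -> R[i].

(** Stated on the two parts because [csum] is defined by two real limits. *)
Definition ccvg u (l : R[i]) : Prop :=
  (fun n => complex.Re (u n)) @ \oo --> complex.Re l /\
  (fun n => complex.Im (u n)) @ \oo --> complex.Im l.

Lemma ccvg_unique u l l' : ccvg u l -> ccvg u l' -> l = l'.
Proof.
move=> [r i] [r' i']; apply: complex_ext.
- exact: cvg_unique r r'.
- exact: cvg_unique i i'.
Qed.

Lemma ccvg_cst l : ccvg (fun=> l) l.
Proof. by split; exact: cvg_cst. Qed.

Lemma ccvgD u v l l' : ccvg u l -> ccvg v l' -> ccvg (fun n => u n + v n) (l + l').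
Proof.
move=> [r i] [r' i']; split.
- rewrite ReD (_ : (fun _ => _) = (fun n => complex.Re (u n)) \+ (fun n => complex.Re (v n))).
    exact: cvgD.
  by apply/funext => n /=; rewrite ReD.
- rewrite ImD (_ : (fun _ => _) = (fun n => complex.Im (u n)) \+ (fun n => complex.Im (v n))).
    exact: cvgD.
  by apply/funext => n /=; rewrite ImD.
Qed.

Lemma ccvgMl c u l : ccvg u l -> ccvg (fun n => c * u n) (c * l).
Proof.
move=> [r i]; split.
- rewrite ReM (_ : (fun _ => _) = (fun n => complex.Re c * complex.Re (u n) -
    complex.Im c * complex.Im (u n))); last by apply/funext => n /=; rewrite ReM.
  by apply: cvgB; apply: cvgM => //; exact: cvg_cst.
- rewrite ImM (_ : (fun _ => _) = (fun n => complex.Re c * complex.Im (u n) +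
    complex.Im c * complex.Re (u n))); last by apply/funext => n /=; rewrite ImM.
  by apply: cvgD; apply: cvgM => //; exact: cvg_cst.
Qed.

Lemma ccvg_sum (u : nat -> nat -> R[i]) (l : nat -> R[i]) n :
  (forall j, ccvg (u j) (l j)) ->
  ccvg (fun k => \sum_(j < n) u j k) (\sum_(j < n) l j).
Proof.
move=> ul; elim: n => [|n IH].
  rewrite big_ord0 (_ : (fun _ => _) = (fun=> 0)); first exact: ccvg_cst.
  by apply/funext => k; rewrite big_ord0.
rewrite big_ord_recr/= (_ : (fun _ => _) = (fun k => \sum_(j < n) u j k + u n k)).
  exact: ccvgD.
by apply/funext => k; rewrite big_ord_recr.
Qed.

Lemma ccvg_csum u l : ccvg (fun n => \sum_(k < n) u k) l -> csum u = l.
Proof.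
move=> [r i]; apply: complex_ext => /=; apply/cvg_lim => //.
- rewrite (_ : series _ = (fun n => complex.Re (\sum_(k < n) u k)))//.
  by apply/funext => n; rewrite /series/= big_mkord Re_sum.
- rewrite (_ : series _ = (fun n => complex.Im (\sum_(k < n) u k)))//.
  by apply/funext => n; rewrite /series/= big_mkord Im_sum.
Qed.

Lemma csum_fin u n : (forall k, (n <= k)%N -> u k = 0) ->
  csum u = \sum_(k < n) u k.
Proof.
move=> u0; apply: ccvg_csum.
have E N : (n <= N)%N -> \sum_(k < N) u k = \sum_(k < n) u k.
  move=> nN; rewrite -(subnKC nN) big_split_ord/= [X in _ + X]big1 ?addr0//.
  by move=> i _; rewrite u0// leq_addr.
split; apply: cvg_near_cst; near=> N => /=; rewrite E//; near: N;
  exact: nbhs_infty_ge.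
Unshelve. all: by end_near.
Qed.

End ComplexSequences.

(** * Bounded operators on the space of square summable sequences *)

Section SquareSummable.
Context {R : realType}.
Implicit Types (x y : nat -> R[i]) (b : ell2 R).

(** Stated for raw sequences, so that iterates and truncations can be estimated before they are
    known to lie in [ell2]. A bound on all partial sums also survives coordinatewise limits. *)
Definition l2b x (M : R) : Prop := forall N, \sum_(k < N) cmod (x k) ^+ 2 <= M.

Definition sqn b : R := fine (l2sum b).

Lemma csq_ge0 (z : R[i]) : (0 <= (cmod z ^+ 2)%:E)%E.
Proof. by rewrite lee_fin sqr_ge0. Qed.

Lemma l2b_sum x M : l2b x M -> (l2sum x <= M%:E)%E.
Proof.
move=> xM; apply: lime_le.
  by apply: is_cvg_nneseries => n _ _; exact: csq_ge0.
by apply: nearW => n; rewrite sumEFin lee_fin big_mkord.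
Qed.

Lemma l2b_mem x M : l2b x M -> x \in l2pred.
Proof. by move=> /l2b_sum xM; rewrite unfold_in (le_lt_trans xM) ?ltry. Qed.

Lemma l2sum_sqn b : l2sum b = (sqn b)%:E.
Proof.
rewrite fineK// ge0_fin_numE; last first.
  by apply: nneseries_ge0 => n _ _; exact: csq_ge0.
by case: b.
Qed.

Lemma l2b_sqn b : l2b b (sqn b).
Proof.
move=> N; rewrite -lee_fin -l2sum_sqn.
apply: le_trans (nneseries_lim_ge N _) => [|n _ _]; last exact: csq_ge0.
by rewrite sumEFin big_mkord.
Qed.

Lemma sqn_le b M : l2b b M -> sqn b <= M.
Proof. by move=> /l2b_sum; rewrite l2sum_sqn lee_fin. Qed.

Lemma sqn_ge0 b : 0 <= sqn b.
Proof. by have := l2b_sqn b 0; rewrite big_ord0. Qed.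

Lemma coord_le_sqn b i : cmod (b i) ^+ 2 <= sqn b.
Proof.
apply: le_trans (l2b_sqn b i.+1).
by rewrite big_ord_recr/= lerDr sumr_ge0// => *; rewrite sqr_ge0.
Qed.

Lemma sqn_eq0 b : sqn b = 0 -> b = 0.
Proof.
move=> b0; apply: val_inj; apply/funext => i; apply: cmod_sqr_eq0.
by apply/eqP; rewrite eq_le sqr_ge0 -b0 coord_le_sqn.
Qed.

Lemma ell2_ext b (c : ell2 R) : (forall i, b i = c i) -> b = c.
Proof. by move=> bc; apply: val_inj; apply/funext. Qed.

Lemma sqn_cvg b : \sum_(k < n) cmod (b k) ^+ 2 @[n --> \oo] --> sqn b.
Proof.
have /fine_cvgP[_] : (fun n => \sum_(0 <= k < n) (cmod (b k) ^+ 2)%:E)%E @ \oo -->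
    (sqn b)%:E.
  rewrite -l2sum_sqn; apply: is_cvg_nneseries => n _ _; exact: csq_ge0.
apply: cvg_trans; apply: near_eq_cvg; apply: nearW => n /=.
by rewrite sumEFin/= big_mkord.
Qed.

Lemma sqn_tail b e : 0 < e ->
  exists N, forall n m, (N <= n)%N -> \sum_(n <= k < m) cmod (b k) ^+ 2 <= e.
Proof.
move=> e0; have /cvgrPdist_le/(_ e e0)[N _ HN] := @sqn_cvg b.
exists N => n m Nn; have := HN n Nn; rewrite /= => h.
have [mn|nm] := leqP m n; first by rewrite big_geq// ltW.
have -> : \sum_(n <= k < m) cmod (b k) ^+ 2 =
    \sum_(k < m) cmod (b k) ^+ 2 - \sum_(k < n) cmod (b k) ^+ 2.
  rewrite -(big_mkord xpredT (fun k => cmod (b k) ^+ 2)).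
  rewrite -(big_mkord xpredT (fun k => cmod (b k) ^+ 2)).
  by rewrite (@big_cat_nat _ _ _ n 0 m)//= ?(ltnW nm)// [RHS]addrAC subrr add0r.
apply: le_trans h; apply: le_trans (ler_norm _); rewrite lerD2r.
exact: l2b_sqn.
Qed.

Lemma hnormE b : hnorm l2dot b = Num.sqrt (sqn b).
Proof.
rewrite /hnorm; congr Num.sqrt; rewrite /=.
apply: cvg_lim => //; apply: cvg_trans; last exact: (@sqn_cvg b).
apply: near_eq_cvg; apply: nearW => n /=.
rewrite /series/= big_mkord; apply: eq_bigr => k _.
by rewrite cmod_sqrE.
Qed.

Lemma l2dot_unit i b : l2dot (l2unit i) b = b i.
Proof.
rewrite /l2dot (@csum_fin _ _ i.+1) => [|k ik] /=; last first.
  by rewrite gtn_eqF// conjC0 mul0r.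
rewrite big_ord_recr/= eqxx conjC1 mul1r big1 ?add0r// => k _.
by rewrite ltn_eqF// conjC0 mul0r.
Qed.

(** In R[i], [0 <= z] says that z is real and nonnegative, so the imaginary series is identically
    zero. *)
Lemma l2dot_ge0 b (c : ell2 R) : (forall i, 0 <= (b i)^* * c i) ->
  0 <= l2dot b c.
Proof.
move=> bc; rewrite /l2dot /csum lecE/=; apply/andP; split.
  rewrite (_ : series _ = fun=> 0); first by rewrite lim_cst.
  apply/funext => n; rewrite /series/= big1// => k _.
  by have := bc k; rewrite lecE/= => /andP[/eqP].
(* For a divergent series [lim] is the default point, which is 0 in R. *)
have [cv|/dvgP ->//] := pselect (cvgn (series (fun n => complex.Re ((b n)^* * c n)))).
apply: limr_ge => //; apply: nearW => n; apply: sumr_ge0 => k _.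
by have := bc k; rewrite lecE/= => /andP[_].
Qed.

(* [c] bounds the square of the operator norm. *)
Definition bounded_by (T : ell2 R -> ell2 R) (c : R) : Prop :=
  [/\ linear T, 0 <= c & forall x : ell2 R, sqn (T x) <= c * sqn x].

Lemma hnorm_le1 b : hnorm l2dot b <= 1 -> sqn b <= 1.
Proof.
rewrite hnormE => h; rewrite -(sqr_sqrtr (sqn_ge0 b)) -(expr1n _ 2).
by rewrite ler_sqr ?nnegrE ?sqrtr_ge0.
Qed.

Lemma opnorm_le T c : bounded_by T c ->
  (opnorm l2dot T <= (Num.sqrt c)%:E)%E.
Proof.
move=> [_ c0 Tc]; apply: ub_ereal_sup => _ [x /= /hnorm_le1 x1 <-].
rewrite lee_fin hnormE ler_wsqrtr// (le_trans (Tc x))//.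
by rewrite -[leRHS]mulr1 ler_wpM2l.
Qed.

Lemma bounded_by_op T c : bounded_by T c -> bounded_op l2dot T.
Proof.
move=> Tc; split; first by case: Tc.
by rewrite (le_lt_trans (opnorm_le Tc)) ?ltry.
Qed.

Lemma bounded_by_comp S T c d : bounded_by S c -> bounded_by T d ->
  bounded_by (S \o T) (c * d).
Proof.
move=> [lS c0 Sc] [lT d0 Td]; split => [a x y /=||x /=].
- by rewrite lT lS.
- exact: mulr_ge0.
- by rewrite (le_trans (Sc _))// -mulrA ler_wpM2l.
Qed.

Lemma sqnD b (c : ell2 R) : sqn (b + c) <= 2 * (sqn b + sqn c).
Proof.
apply: sqn_le => N; apply: (@le_trans _ _ (\sum_(k < N)
    2 * (cmod (b k) ^+ 2 + cmod (c k) ^+ 2))).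
  by apply: ler_sum => k _; exact: cmod_sqrD2.
by rewrite -mulr_sumr big_split/= ler_pM2l// lerD// l2b_sqn.
Qed.

Lemma bounded_by_add S T c d : bounded_by S c -> bounded_by T d ->
  bounded_by (fun x : ell2 R => S x + T x) (2 * (c + d)).
Proof.
move=> [lS c0 Sc] [lT d0 Td]; split => [a x y /=||x /=].
- by rewrite lT lS scalerDr addrACA.
- by rewrite mulr_ge0 ?addr_ge0.
- by rewrite (le_trans (sqnD _ _))// -mulrA ler_pM2l// mulrDl lerD.
Qed.

(** Row-finite matrices, acting on all sequences and not only on [ell2]. *)
Definition local (T : (nat -> R[i]) -> nat -> R[i]) : Prop :=
  forall i, exists n (m : nat -> R[i]), forall x, T x i = \sum_(j < n) m j * x j.

(* As above, [c] bounds the square of the norm. Locality makes the operator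
   continuous for coordinatewise convergence, so that limits in ell2 can be
   taken coordinate by coordinate. *)
Record lop (T : (nat -> R[i]) -> nat -> R[i]) (c : R) : Prop := Lop {
  lop_ge0 : 0 <= c;
  lop_local : local T;
  lop_bound : forall x M, l2b x M -> l2b (T x) (c * M) }.

Definition ell2_op T c (h : lop T c) : ell2 R -> ell2 R :=
  fun x : ell2 R => Ell2 (l2b_mem (lop_bound h (l2b_sqn x))).

Lemma local_linear T : local T -> forall i a x y,
  T (fun k => a * x k + y k) i = a * T x i + T y i.
Proof.
move=> lT i a x y; have [n [m E]] := lT i; rewrite !E mulr_sumr -big_split/=.
by apply: eq_bigr => j _; rewrite mulrDr !mulrA [m j * a]mulrC.
Qed.

Lemma ell2_op_bounded T c (h : lop T c) : bounded_by (ell2_op h) c.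
Proof.
split => [a x y||x]; last exact/sqn_le/(lop_bound h (l2b_sqn x)).
- by apply: ell2_ext => i; exact: (local_linear (lop_local h)).
- exact: lop_ge0 h.
Qed.

Lemma local_comp S T : local S -> local T -> local (S \o T).
Proof.
move=> lS lT i; have [n [m E]] := lS i.
have /choice[g gP] : forall j, exists p : nat * (nat -> R[i]),
    forall x, T x j = \sum_(l < p.1) p.2 l * x l.
  by move=> j; have [p [q]] := lT j; exists (p, q).
(* The sum of the row lengths serves as a common bound for them; shorter rows are padded with
   zeros. *)
pose N := (\sum_(j < n) (g j).1)%N.
pose e j l := if (l < (g j).1)%N then (g j).2 l else 0.
have Te (x : nat -> R[i]) (j : 'I_n) : T x j = \sum_(l < N) e j l * x l.
  have le : ((g j).1 <= N)%N by rewrite /N (bigD1 j)//= leq_addr.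
  rewrite gP (big_ord_widen N (fun l => (g j).2 l * x l) le) big_mkcond/=.
  by apply: eq_bigr => l _; rewrite /e; case: ifP => //; rewrite mul0r.
exists N, (fun l => \sum_(j < n) m j * e j l) => x /=; rewrite E.
transitivity (\sum_(j < n) \sum_(l < N) m j * (e j l * x l)).
  by apply: eq_bigr => j _; rewrite (Te x j) mulr_sumr.
rewrite exchange_big/=; apply: eq_bigr => l _; rewrite mulr_suml.
by apply: eq_bigr => j _; rewrite mulrA.
Qed.

Lemma lop_comp S T c d : lop S c -> lop T d -> lop (S \o T) (c * d).
Proof.
move=> [c0 lS Sc] [d0 lT Td]; split; first exact: mulr_ge0.
- exact: local_comp.
- by move=> x M /Td/Sc; rewrite mulrA.
Qed.

End SquareSummable.

(** * Neumann series *)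

Section Neumann.
Context {R : realType} (K : (nat -> R[i]) -> nat -> R[i]) (q : R).
Hypotheses (Kq : lop K q) (q1 : q < 1).
Implicit Types (b : ell2 R).

Let q0 : 0 <= q := lop_ge0 Kq.

(* The triangle inequality is replaced by [cmod_sqrD] with the weight
   [t = (1 + q) / 2], for which [q / t < 1]. *)
Lemma perturb_l2b b (x y : nat -> R[i]) M : l2b x M ->
  (forall i, y i + K x i = b i) ->
  l2b y (2 / (1 - q) * sqn b + 2 * q / (1 + q) * M).
Proof.
move=> xM E N.
have t : 0 < (1 + q) / 2 < 1.
  by move: q0 q1 => ? ?; apply/andP; split; lra.
apply: (@le_trans _ _ (\sum_(k < N) (cmod (b k) ^+ 2 / (1 - (1 + q) / 2) +
    cmod (K x k) ^+ 2 / ((1 + q) / 2)))).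
  apply: ler_sum => k _.
  have -> : y k = b k - K x k by rewrite -E addrK.
  by apply: le_trans (cmod_sqrD _ _ t) _; rewrite cmodN.
rewrite big_split/= -!mulr_suml.
have := l2b_sqn b N; have := lop_bound Kq xM N.
set u := \sum_(_ < _) _; set v := \sum_(_ < _) _ => uM vb.
have -> : 1 - (1 + q) / 2 = (1 - q) / 2 by field.
rewrite !invf_div mulrC [u * _]mulrC.
have q1' : 0 < 1 - q by rewrite subr_gt0.
have q1'' : 0 < 1 + q by move: q0 => ?; lra.
apply: lerD; first by rewrite ler_pM2l ?divr_gt0.
rewrite -[2 * q / _]mulrAC -[2 / _ * q * _]mulrA.
by rewrite ler_pM2l ?divr_gt0.
Qed.

(** The solution c of c = 2/(1-q) + (2q/(1+q)) c: the multiple of [sqn b] that the estimate of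
    [perturb_l2b] reproduces, hence an invariant bound for the iteration. *)
Definition neumann_cst : R := 2 * (1 + q) / (1 - q) ^+ 2.

Lemma neumann_fixed (s : R) :
  2 / (1 - q) * s + 2 * q / (1 + q) * (neumann_cst * s) = neumann_cst * s.
Proof.
have q1' : 0 < 1 - q by rewrite subr_gt0.
have q1'' : 0 < 1 + q by move: q0 => ?; lra.
by rewrite /neumann_cst; field; rewrite !gt_eqF.
Qed.

Lemma neumann_cst_ge0 : 0 <= neumann_cst.
Proof.
by rewrite divr_ge0 ?sqr_ge0// mulr_ge0// addr_ge0.
Qed.

(** [perturb_l2b] with y = x bounds [sqn x] by itself with the factor 2q/(1+q) < 1, and can be
    solved for it. Uniqueness of solutions and boundedness of the inverse both follow. *)
Lemma neumann_bound b (x : ell2 R) : (forall i, x i + K x i = b i) ->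
  sqn x <= neumann_cst * sqn b.
Proof.
move=> E; have := perturb_l2b (l2b_sqn x) E => /sqn_le.
rewrite -subr_ge0 -(subr_ge0 (sqn x)) -neumann_fixed.
have q1' : 0 < 1 - q by rewrite subr_gt0.
have q1'' : 0 < 1 + q by move: q0 => ?; lra.
set s := sqn x; set c := sqn b => h.
(* The factor (1+q)/(1-q) is the inverse of 1 - 2q/(1+q). *)
have -> : 2 / (1 - q) * c + 2 * q / (1 + q) * (neumann_cst * c) - s =
  (1 + q) / (1 - q) * (2 / (1 - q) * c + 2 * q / (1 + q) * s - s).
  by rewrite /neumann_cst; field; rewrite !gt_eqF.
by apply: mulr_ge0 h; rewrite divr_ge0// ltW.
Qed.

(** Fixed-point iteration for x = b - K x from 0; for n > 0 these are the partial sums of the series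
    of [(-K)^k b]. *)
Fixpoint neumann_seq b n : nat -> R[i] :=
  if n is n'.+1 then fun i => b i - K (neumann_seq b n') i else fun=> 0.

Lemma neumann_seq_l2b b n : l2b (neumann_seq b n) (neumann_cst * sqn b).
Proof.
elim: n => [|n IH] /=.
  move=> N; rewrite big1 => [|k _]; last by rewrite cmod0 expr0n.
  exact: mulr_ge0 neumann_cst_ge0 (sqn_ge0 b).
by rewrite -neumann_fixed; apply: perturb_l2b IH _ => i; rewrite subrK.
Qed.

Let diff b n i := neumann_seq b n.+1 i - neumann_seq b n i.

Lemma local_sub (T : (nat -> R[i]) -> nat -> R[i]) : local T ->
  forall i x y, T (fun k => x k - y k) i = T x i - T y i.
Proof.
move=> lT i x y.
have := local_linear lT i (-1) y x; rewrite mulN1r addrC => <-.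
by congr T; apply/funext => k; rewrite mulN1r addrC.
Qed.

(** The difference is [(-K)^n b], and q bounds the squared norm of [K]. *)
Lemma neumann_diff b n : l2b (diff b n) (q ^+ n * sqn b).
Proof.
elim: n => [|n IH].
  rewrite expr0 mul1r => N; apply: le_trans (l2b_sqn b N).
  rewrite le_eqVlt; apply/orP; left; apply/eqP; apply: eq_bigr => k _.
  rewrite /diff/= subr0.
  have -> : K (fun=> 0) k = 0.
    have [m [c ->]] := lop_local Kq k.
    by rewrite big1// => j _; rewrite mulr0.
  by rewrite subr0.
have -> : diff b n.+1 = fun i => - K (diff b n) i.
  apply/funext => i; rewrite /diff (local_sub (lop_local Kq)) /=.
  by rewrite opprB opprB addrC addrA subrK.
move=> N; have := lop_bound Kq IH N; rewrite mulrA -exprS.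
by under eq_bigr do rewrite -cmodN.
Qed.

(** At a fixed coordinate the differences are dominated by a geometric series of ratio sqrt q. *)
Lemma neumann_coord_cvg b i :
  exists l, ccvg (fun n => neumann_seq b n i) l.
Proof.
have sq1 : `|Num.sqrt q| < 1.
  by rewrite ger0_norm ?sqrtr_ge0// -sqrtr1 ltr_sqrt.
have key (f : R[i] -> R) : (forall z, `|f z| <= cmod z) ->
    cvgn (series (fun n => f (diff b n i))).
  move=> fle; apply: normed_cvg.
  apply: (@series_le_cvg _ _ (geometric (Num.sqrt (sqn b)) (Num.sqrt q))).
  - by move=> n /=; rewrite normr_ge0.
  - by move=> n /=; rewrite mulr_ge0 ?exprn_ge0 ?sqrtr_ge0.
  - move=> n /=; apply: (le_trans (fle _)).
    rewrite -ler_sqr ?nnegrE ?cmod_ge0 ?mulr_ge0 ?exprn_ge0 ?sqrtr_ge0//.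
    rewrite exprMn -exprM mulnC exprM !sqr_sqrtr ?sqn_ge0// mulrC.
    apply: le_trans (neumann_diff b n i.+1).
    by rewrite big_ord_recr/= lerDr sumr_ge0// => *; rewrite sqr_ge0.
  - exact: is_cvg_geometric_series.
have tel (f : R[i] -> R) : f 0 = 0 -> (forall z w, f (z - w) = f z - f w) ->
    series (fun n => f (diff b n i)) = fun n => f (neumann_seq b n i).
  move=> f0 fB; apply/funext => n; rewrite /series/=.
  under eq_bigr do rewrite /diff fB.
  by rewrite telescope_sumr// f0 subr0.
have := key _ (@Re_le_cmod R); rewrite tel//; last by case=> [? ?] [? ?].
have := key _ (@Im_le_cmod R); rewrite tel//; last by case=> [? ?] [? ?].
move=> cI cR; exists (Complex (limn (fun n => complex.Re (neumann_seq b n i)))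
  (limn (fun n => complex.Im (neumann_seq b n i)))).
by split.
Qed.

(** The uniform bound on the iterates puts their coordinatewise limit in [ell2], and the equation
    passes to the limit because each row of [K] is finite. *)
Theorem neumann b : exists x : ell2 R, forall i, x i + K x i = b i.
Proof.
have /choice[x xP] := neumann_coord_cvg b.
have xb : l2b x (neumann_cst * sqn b).
  move=> N.
  have cv : \sum_(k < N) cmod (neumann_seq b n k) ^+ 2 @[n --> \oo] -->
      \sum_(k < N) cmod (x k) ^+ 2.
    apply: cvg_big => [|k _]; first exact: add_continuous.
     have [cR cI] := xP k.
    under eq_fun do rewrite cmod_sqr !expr2.
    by rewrite cmod_sqr !expr2; apply: cvgD; apply: cvgM.
  apply: (cvgr_to_le cv).
  by apply: nearW => n; exact: neumann_seq_l2b.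
exists (Ell2 (l2b_mem xb)) => i /=.
have [n [m E]] := lop_local Kq i; rewrite E.
(* Pairing iterate k + 1 with [K] of iterate k gives a sequence that is constantly [b i]. *)
have c1 : ccvg (fun k => neumann_seq b k.+1 i + \sum_(j < n) m j * neumann_seq b k j)
   (x i + \sum_(j < n) m j * x j).
  apply: ccvgD; last first.
    by apply: (@ccvg_sum _ (fun j k => m j * neumann_seq b k j) (fun j => m j * x j)) => j;
      exact: ccvgMl.
  by have [cR cI] := xP i; split;
    [move: cR; rewrite -cvg_shiftS|move: cI; rewrite -cvg_shiftS].
apply: (ccvg_unique c1).
rewrite (_ : (fun _ => _) = fun=> b i); first exact: ccvg_cst.
by apply/funext => k /=; rewrite E subrK.
Qed.

End Neumann.

(** * The factors of the CMV matrix *)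

Lemma sum_pairs (V : nmodType) (f : nat -> V) n :
  \sum_(i < n.*2) f i = \sum_(k < n) (f k.*2 + f k.*2.+1).
Proof.
elim: n => [|n IH]; first by rewrite !big_ord0.
by rewrite doubleS !big_ord_recr/= IH addrA.
Qed.

Section Blocks.
Context {R : realType}.
Implicit Types (T : nat -> 'M[R[i]]_2) (x : nat -> R[i]).

(** The operator with matrix [mx_blocks T], by a finite formula; [csum_mx_blocks] links it to
    [csum]. *)
Definition blk T x i : R[i] :=
  T i./2 (inord (odd i)) (inord 0) * x i./2.*2 +
  T i./2 (inord (odd i)) (inord 1) * x i./2.*2.+1.

Lemma blk_even T x k : blk T x k.*2 =
  T k (inord 0) (inord 0) * x k.*2 + T k (inord 0) (inord 1) * x k.*2.+1.
Proof. by rewrite /blk odd_double doubleK. Qed.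

Lemma blk_odd T x k : blk T x k.*2.+1 =
  T k (inord 1) (inord 0) * x k.*2 + T k (inord 1) (inord 1) * x k.*2.+1.
Proof. by rewrite /blk/= odd_double uphalf_double. Qed.

Lemma even_odd_ind (P : nat -> Prop) :
  (forall k, P k.*2) -> (forall k, P k.*2.+1) -> forall i, P i.
Proof.
by move=> Pe Po i; rewrite -(odd_double_half i); case: (odd i); rewrite ?add0n ?add1n.
Qed.

Lemma local_blk T : local (blk T).
Proof.
apply: even_odd_ind => k.
- exists k.*2.+2, (fun j => if j == k.*2 then T k (inord 0) (inord 0) else
    if j == k.*2.+1 then T k (inord 0) (inord 1) else 0) => x.
  rewrite blk_even !big_ord_recr/= eqxx gtn_eqF// eqxx big1 ?add0r// => j _.
  by rewrite (ltn_eqF (ltn_ord j)) (ltn_eqF (ltnW (ltn_ord j) : (j < k.*2.+1)%N)) mul0r.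
- exists k.*2.+2, (fun j => if j == k.*2 then T k (inord 1) (inord 0) else
    if j == k.*2.+1 then T k (inord 1) (inord 1) else 0) => x.
  rewrite blk_odd !big_ord_recr/= eqxx gtn_eqF// eqxx big1 ?add0r// => j _.
  by rewrite (ltn_eqF (ltn_ord j)) (ltn_eqF (ltnW (ltn_ord j) : (j < k.*2.+1)%N)) mul0r.
Qed.

Definition block_isometry T := forall k u v,
  cmod (T k (inord 0) (inord 0) * u + T k (inord 0) (inord 1) * v) ^+ 2 +
  cmod (T k (inord 1) (inord 0) * u + T k (inord 1) (inord 1) * v) ^+ 2 =
  cmod u ^+ 2 + cmod v ^+ 2.

Lemma lop_blk T : block_isometry T -> lop (blk T) 1.
Proof.
move=> iT; split => // [|x M xM N]; first exact: local_blk.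
(* An odd [N] would cut a block in two; the first [N.*2] rows consist of whole blocks. *)
rewrite mul1r; apply: le_trans (xM N.*2).
apply: (@le_trans _ _ (\sum_(i < N.*2) cmod (blk T x i) ^+ 2)); last first.
  rewrite !(sum_pairs (fun i => cmod (_ i) ^+ 2)) le_eqVlt; apply/orP; left.
  by apply/eqP/eq_bigr => k _; rewrite blk_even blk_odd iT.
rewrite -addnn big_split_ord/= lerDl sumr_ge0// => i _.
exact: sqr_ge0.
Qed.

Definition one_plus (S : (nat -> R[i]) -> nat -> R[i]) x i : R[i] :=
  if i is i'.+1 then S (fun k => x k.+1) i' else x 0.

Lemma lop_one_plus S : lop S 1 -> lop (one_plus S) 1.
Proof.
move=> [_ lS bS]; split => //.
- case=> [|i] /=; first by exists 1, (fun=> 1) => x; rewrite big_ord1 mul1r.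
  have [n [m E]] := lS i.
  exists n.+1, (fun j => if j is j'.+1 then m j' else 0) => x.
  by rewrite E big_ord_recl mul0r add0r.
- move=> x M xM [|N].
    by have := xM 0; rewrite !big_ord0 mul1r.
  rewrite big_ord_recl/= mul1r -lerBrDl.
  have := bS (fun k => x k.+1) (M - cmod (x 0) ^+ 2); rewrite mul1r; apply => n.
  by have := xM n.+1; rewrite big_ord_recl/= -lerBrDl.
Qed.

Lemma mx_blocks_unit T i j :
  blk T (fun k => (k == j)%:R) i = mx_blocks T i j.
Proof.
rewrite /mx_blocks /blk; case: (eqVneq i./2 j./2) => [->|ij].
  have := odd_double_half j; move: (odd j) (j./2) => o h <-; case: o => /=.
    by rewrite add1n eqxx ltn_eqF// mulr0 mulr1 add0r.
  by rewrite add0n eqxx gtn_eqF// mulr0 mulr1 addr0.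
have [E|_] := eqVneq i./2.*2 j; first by rewrite -E doubleK eqxx in ij.
have [E|_] := eqVneq i./2.*2.+1 j; last by rewrite !mulr0 addr0.
by rewrite -E /= uphalf_double eqxx in ij.
Qed.

Lemma csum_mx_blocks T x i :
  csum (fun k => mx_blocks T i k * x k) = blk T x i.
Proof.
rewrite (@csum_fin _ _ (i./2.+1).*2) => [|k ik]; last first.
  rewrite /mx_blocks ifN ?mul0r// ltn_eqF// -(doubleK i./2.+1).
  exact: half_leq.
rewrite (sum_pairs (fun k => mx_blocks T i k * x k)) big_ord_recr/=.
rewrite big1 => [|k _].
  rewrite add0r /mx_blocks /blk doubleK /= uphalf_double eqxx odd_double.
  by [].
rewrite /mx_blocks doubleK/= uphalf_double gtn_eqF//.
by rewrite !mul0r addr0.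
Qed.

Lemma mx_one_plus_unit T i j :
  one_plus (blk T) (fun k => (k == j)%:R) i = mx_one_plus (mx_blocks T) i j.
Proof.
case: i j => [|i] [|j] //=; last by rewrite mx_blocks_unit.
by rewrite /blk !mulr0 addr0.
Qed.

Lemma blk_comp (S T : nat -> 'M[R[i]]_2) :
  (forall k, S k *m T k = 1%:M) -> forall x, blk S (blk T x) = x.
Proof.
move=> ST x.
have E k p q : S k p (inord 0) * T k (inord 0) q + S k p (inord 1) * T k (inord 1) q =
    (p == q)%:R.
  have := congr1 (fun M : 'M[R[i]]_2 => M p q) (ST k); rewrite !mxE !big_ord_recl big_ord0 addr0.
  rewrite (_ : lift ord0 ord0 = inord 1 :> 'I_2); last first.
    by apply/val_inj; rewrite /= inordK.
  by rewrite (_ : ord0 = inord 0 :> 'I_2)//; apply/val_inj; rewrite /= inordK.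
have n01 : (inord 0 == inord 1 :> 'I_2) = false by rewrite -val_eqE/= !inordK.
have n10 : (inord 1 == inord 0 :> 'I_2) = false by rewrite -val_eqE/= !inordK.
apply/funext; apply: even_odd_ind => k.
- rewrite blk_even blk_even blk_odd.
  transitivity (((inord 0 == inord 0 :> 'I_2)%:R : R[i]) * x k.*2 +
    ((inord 0 == inord 1 :> 'I_2)%:R : R[i]) * x k.*2.+1).
    by rewrite -!(E k); ring.
  by rewrite eqxx n01 mul1r mul0r addr0.
- rewrite blk_odd blk_even blk_odd.
  transitivity (((inord 1 == inord 0 :> 'I_2)%:R : R[i]) * x k.*2 +
    ((inord 1 == inord 1 :> 'I_2)%:R : R[i]) * x k.*2.+1).
    by rewrite -!(E k); ring.
  by rewrite eqxx n10 mul1r mul0r add0r.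
Qed.

Lemma one_plus_comp (S T : (nat -> R[i]) -> nat -> R[i]) :
  (forall x, S (T x) = x) -> forall x, one_plus S (one_plus T x) = x.
Proof.
by move=> ST x; apply/funext => -[|i] //=; rewrite [X in S X](_ : _ = T (fun k => x k.+1))// ST.
Qed.

(** The pairing is bilinear, without conjugation, so a symmetric block matrix moves from one factor
    to the other. This turns an identity between rows into the action of the matrix on a column; the
    range ends with a whole block. *)
Lemma sum_blk_sym T (w Y x : nat -> R[i]) n :
  (forall k, T k (inord 0) (inord 1) = T k (inord 1) (inord 0)) ->
  (forall k, (k < n)%N -> Y k.*2 = blk T w k.*2 /\ Y k.*2.+1 = blk T w k.*2.+1) ->
  \sum_(i < n.*2) Y i * x i = \sum_(i < n.*2) w i * blk T x i.
Proof.
move=> sT Yw; rewrite (sum_pairs (fun i => Y i * x i)).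
rewrite (sum_pairs (fun i => w i * blk T x i)); apply: eq_bigr => k _.
have [-> ->] := Yw k (ltn_ord k).
by rewrite !blk_even !blk_odd sT; ring.
Qed.

Definition dg (d : nat -> R[i]) x i : R[i] := d i * x i.

Lemma lop_dg d c : 0 <= c -> (forall i, cmod (d i) ^+ 2 <= c) -> lop (dg d) c.
Proof.
move=> c0 dc; split => // [i|x M xM N].
- exists i.+1, (fun j => if j == i then d i else 0) => x.
  rewrite big_ord_recr/= eqxx big1 ?add0r// => j _.
  by rewrite ltn_eqF// mul0r.
- apply: (@le_trans _ _ (c * \sum_(k < N) cmod (x k) ^+ 2)); last by rewrite ler_wpM2l.
  rewrite mulr_sumr; apply: ler_sum => k _.
  by rewrite cmodM exprMn ler_wpM2r// sqr_ge0.
Qed.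

End Blocks.

Section CMV.
Context {R : realType} (a : nat -> R[i]).
Hypothesis a1 : forall n, (0 < n)%N -> `|a n| < 1.

Lemma rho_sqr n : (0 < n)%N -> rho a n ^+ 2 = 1 - `|a n| ^+ 2.
Proof. by move=> n0; rewrite /rho sqrtCK. Qed.

Lemma rho_gt0 n : (0 < n)%N -> 0 < rho a n.
Proof.
by move=> n0; rewrite /rho sqrtC_gt0 subr_gt0 expr_lt1 ?a1.
Qed.

Lemma rho_conj n : (0 < n)%N -> (rho a n)^* = rho a n.
Proof. by move=> /rho_gt0/ltW/geC0_conj. Qed.

Lemma ThetaE n : Theta a n (inord 0) (inord 0) = - a n /\
  Theta a n (inord 0) (inord 1) = rho a n /\
  Theta a n (inord 1) (inord 0) = rho a n /\
  Theta a n (inord 1) (inord 1) = (a n)^*.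
Proof. by rewrite !mxE -!val_eqE/= !inordK. Qed.

(** The inverse of [Theta]: entrywise conjugation is the adjoint, because [Theta] is symmetric. *)
Definition Theta_conj n : 'M[R[i]]_2 := \matrix_(p < 2, q < 2) (Theta a n p q)^*.

Lemma Theta_unitary n : (0 < n)%N -> Theta a n *m Theta_conj n = 1%:M.
Proof.
move=> n0; have := rho_sqr n0; rewrite normCK => rs.
apply/matrixP => -[[|[|//]] ?] [[|[|//]] ?]; rewrite !mxE !big_ord_recl big_ord0;
  rewrite !mxE/= ?rmorphN/= ?rho_conj ?conjCK//= ?addr0 -?expr2 ?rs /=; ring.
Qed.

Lemma unitary2_isometry (p q r s u v : R[i]) :
  p^* * p + r^* * r = 1 -> q^* * q + s^* * s = 1 -> p^* * q + r^* * s = 0 ->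
  cmod (p * u + q * v) ^+ 2 + cmod (r * u + s * v) ^+ 2 = cmod u ^+ 2 + cmod v ^+ 2.
Proof.
move=> h1 h2 h3; apply: (@complexI R); rewrite !rmorphD /= -!cmod_sqrE !rmorphD !rmorphM/=.
have h3' : p * q^* + r * s^* = 0.
  have := congr1 (fun z => z^*) h3; rewrite rmorphD !rmorphM/= !conjCK => ->.
  by rewrite conjC0.
transitivity ((p^* * p + r^* * r) * (u^* * u) + (q^* * q + s^* * s) * (v^* * v) +
  (p^* * q + r^* * s) * (u^* * v) + (p * q^* + r * s^*) * (u * v^* )); first by ring.
by rewrite h1 h2 h3 h3' !mul1r !mul0r !addr0.
Qed.

Lemma Theta_isometry n (u v : R[i]) : (0 < n)%N ->
  cmod (- a n * u + rho a n * v) ^+ 2 + cmod (rho a n * u + (a n)^* * v) ^+ 2 =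
  cmod u ^+ 2 + cmod v ^+ 2.
Proof.
move=> n0; have := rho_sqr n0; rewrite normCK => rs.
by apply: unitary2_isometry; rewrite ?rmorphN/= ?rho_conj ?conjCK// -?expr2 ?rs; ring.
Qed.

Lemma Theta_conj_isometry n (u v : R[i]) : (0 < n)%N ->
  cmod ((- a n)^* * u + (rho a n)^* * v) ^+ 2 + cmod ((rho a n)^* * u + (a n)^*^* * v) ^+ 2 =
  cmod u ^+ 2 + cmod v ^+ 2.
Proof.
move=> n0; have := rho_sqr n0; rewrite normCK => rs.
by apply: unitary2_isometry; rewrite ?rmorphN/= ?rho_conj ?conjCK// -?expr2 ?rs; ring.
Qed.

Definition cmv_even := one_plus (blk (fun k => Theta a k.*2.+2)).
Definition cmv_odd := blk (fun k => Theta a k.*2.+1).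
Definition cmv_seq x := cmv_odd (cmv_even x).
Definition cmv_inv x := one_plus (blk (fun k => Theta_conj k.*2.+2))
  (blk (fun k => Theta_conj k.*2.+1) x).

Lemma lop_Theta (f : nat -> nat) : (forall k, (0 < f k)%N) -> lop (blk (fun k => Theta a (f k))) 1.
Proof.
move=> f0; apply: lop_blk => k u v; have [-> [-> [-> ->]]] := ThetaE (f k).
exact: Theta_isometry.
Qed.

Lemma lop_Theta_conj (f : nat -> nat) : (forall k, (0 < f k)%N) ->
  lop (blk (fun k => Theta_conj (f k))) 1.
Proof.
move=> f0; apply: lop_blk => k u v; rewrite !mxE -!val_eqE/= !inordK//=.
exact: Theta_conj_isometry.
Qed.

Lemma lop_cmv : lop cmv_seq 1.
Proof.
rewrite -[1]mulr1; apply: (@lop_comp _ cmv_odd cmv_even); first exact: lop_Theta.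
by apply: lop_one_plus; exact: lop_Theta.
Qed.

Lemma lop_cmv_inv : lop cmv_inv 1.
Proof.
rewrite -[1]mulr1; apply: (@lop_comp _ (one_plus _)); last exact: lop_Theta_conj.
by apply: lop_one_plus; exact: lop_Theta_conj.
Qed.

Lemma cmv_seqK x : cmv_seq (cmv_inv x) = x.
Proof.
rewrite /cmv_seq /cmv_inv /cmv_even one_plus_comp.
- by apply: blk_comp => k; exact: Theta_unitary.
- by apply: blk_comp => k; exact: Theta_unitary.
Qed.

(** Each row of [cmv_o] is supported in one block, so the [csum] in [mx_mul] is finite and the
    matrix product is the composition of the two block operators. *)
Lemma cmv_matrix i j : cmv_seq (fun k => (k == j)%:R) i = cmv a i j.
Proof.
rewrite /cmv /mx_mul /cmv_o csum_mx_blocks /cmv_seq; congr (cmv_odd _ i).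
by apply/funext => k; rewrite /cmv_even mx_one_plus_unit.
Qed.

End CMV.

(** * The operator Moebius transform of the CMV matrix *)

Section MoebiusTransform.
Context {R : realType} (alpha a : nat -> R[i]) (r : R).
Hypothesis a1 : forall n, (0 < n)%N -> `|a n| < 1.
Hypothesis alpha_r : forall n, cmod (alpha n) <= r.
Hypothesis r1 : r < 1.

Let r0 : 0 <= r := le_trans (cmod_ge0 (alpha 0)) (alpha_r 0).

Let rr1 : r ^+ 2 < 1.
Proof. by rewrite expr_lt1. Qed.

Lemma alpha_sqr_le n : cmod (alpha n) ^+ 2 <= r ^+ 2.
Proof. by rewrite ler_sqr// nnegrE// cmod_ge0. Qed.

(** As A is diagonal, A A^dag = A^dag A, and these are the diagonal entries of both [eta_A] and
    [eta_{A^dag}]. *)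
Definition eta n : R[i] := (Num.sqrt (1 - cmod (alpha n) ^+ 2))%:C%C.

Lemma eta_arg_gt0 n : 0 < 1 - cmod (alpha n) ^+ 2.
Proof. by rewrite subr_gt0 (le_lt_trans (alpha_sqr_le n)). Qed.

Lemma eta_gt0 n : 0 < eta n.
Proof. by rewrite ltcR sqrtr_gt0 eta_arg_gt0. Qed.

Lemma eta_neq0 n : eta n != 0.
Proof. by rewrite gt_eqF// eta_gt0. Qed.

Lemma cmod_eta n : cmod (eta n) ^+ 2 = 1 - cmod (alpha n) ^+ 2.
Proof.
by rewrite cmod_sqr/= expr0n addr0 sqr_sqrtr// ltW// eta_arg_gt0.
Qed.

Lemma eta_sqr n : eta n * eta n = 1 - alpha n * (alpha n)^*.
Proof.
rewrite [alpha n * _]mulrC cmod_sqrE -expr2 -rmorphXn/= sqr_sqrtr ?rmorphB//.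
by rewrite ltW// eta_arg_gt0.
Qed.

Lemma eta_le1 n : cmod (eta n) ^+ 2 <= 1.
Proof. by rewrite cmod_eta gerBl sqr_ge0. Qed.

(** The uniform bound r < 1 keeps [eta] away from 0, which makes eta^-1 a bounded operator. *)
Lemma etaV_le n : cmod (eta n)^-1 ^+ 2 <= (1 - r ^+ 2)^-1.
Proof.
have -> : cmod (eta n)^-1 ^+ 2 = (cmod (eta n) ^+ 2)^-1.
  have h : cmod (eta n) * cmod (eta n)^-1 = 1.
    by rewrite -cmodM divff ?cmod1// eta_neq0.
  have e0 : cmod (eta n) != 0.
    by apply/eqP => e0; move/eqP: h; rewrite e0 mul0r eq_sym oner_eq0.
  by rewrite -exprVn; congr (_ ^+ 2); apply: (mulfI e0); rewrite h divff.
by rewrite cmod_eta lef_pV2 ?posrE ?eta_arg_gt0 ?subr_gt0// lerB// alpha_sqr_le.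
Qed.

Definition aconj n : R[i] := (alpha n)^*.

Let lop_alpha : lop (dg alpha) (r ^+ 2).
Proof. by apply: lop_dg (sqr_ge0 _) alpha_sqr_le. Qed.

Let lop_aconj : lop (dg aconj) (r ^+ 2).
Proof.
by apply: lop_dg (sqr_ge0 _) _ => n; rewrite cmod_conj alpha_sqr_le.
Qed.

Let lop_eta : lop (dg eta) 1.
Proof. exact: lop_dg ler01 eta_le1. Qed.

Let lop_etaV : lop (dg (fun n => (eta n)^-1)) (1 - r ^+ 2)^-1.
Proof.
by apply: lop_dg etaV_le; rewrite invr_ge0 subr_ge0 ltW.
Qed.

Let lop_C : lop (cmv_seq a) 1 := lop_cmv a1.

Let lop_K : lop (dg aconj \o cmv_seq a) (r ^+ 2).
Proof. by rewrite -[r ^+ 2]mulr1; exact: lop_comp. Qed.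

Lemma moebius_solve (b : ell2 R) :
  exists x : ell2 R, forall i, x i + (alpha i)^* * cmv_seq a x i = b i.
Proof. exact: (neumann lop_K rr1). Qed.

(** C + A = (1 + A C^-1) C, and A C^-1 has squared norm at most r^2, so the Neumann series applies
    again. *)
Lemma moebius_solve' (b : ell2 R) :
  exists x : ell2 R, forall i, cmv_seq a x i + alpha i * x i = b i.
Proof.
have lK : lop (dg alpha \o cmv_inv a) (r ^+ 2).
  by rewrite -[r ^+ 2]mulr1; apply: lop_comp => //; exact: lop_cmv_inv.
have [y yP] := neumann lK rr1 b.
exists (ell2_op (lop_cmv_inv a1) y) => i.
rewrite (_ : ell2_val _ = cmv_inv a y)// cmv_seqK//.
Qed.

Lemma moebius_uniq (b x y : ell2 R) :
  (forall i, x i + (alpha i)^* * cmv_seq a x i = b i) ->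
  (forall i, y i + (alpha i)^* * cmv_seq a y i = b i) -> x = y.
Proof.
move=> xb yb; apply/eqP; rewrite -subr_eq0; apply/eqP/sqn_eq0.
apply/eqP; rewrite eq_le sqn_ge0 andbT.
have /(_ (x - y)) := neumann_bound lop_K rr1 (b := 0).
have -> : sqn 0 = 0 :> R.
  apply/eqP; rewrite eq_le sqn_ge0 andbT; apply: sqn_le => N.
  by rewrite big1// => k _; rewrite cmod0 expr0n.
rewrite mulr0; apply => i; rewrite /= /dg /aconj.
rewrite (local_sub (lop_local lop_C)).
by rewrite mulrBr addrACA -opprD xb yb subrr.
Qed.

(** [W] is obtained by choosing solutions; uniqueness makes it linear and a two-sided inverse. The
    last clause keeps, for each column of U, the vector x that the truncation argument will cut
    off. *)
Lemma moebius_exists : exists A C U : ell2 R -> ell2 R,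
  [/\ is_operator_of (mx_diag alpha) A, is_operator_of (cmv a) C,
      is_moebius l2dot A C U, bounded_op l2dot U &
      forall j, exists x : ell2 R,
        (forall i, x i + (alpha i)^* * cmv_seq a x i = eta i * (i == j)%:R) /\
        (forall i, U (l2unit j) i = (eta i)^-1 * (cmv_seq a x i + alpha i * x i))].
Proof.
have /choice[W WP] := moebius_solve.
pose A := ell2_op lop_alpha; pose Ad := ell2_op lop_aconj.
pose C := ell2_op lop_C; pose E := ell2_op lop_eta; pose V := ell2_op lop_etaV.
have bA : bounded_by A (r ^+ 2) by exact: ell2_op_bounded.
have bAd : bounded_by Ad (r ^+ 2) by exact: ell2_op_bounded.
have bC : bounded_by C 1 by exact: ell2_op_bounded.
have bE : bounded_by E 1 by exact: ell2_op_bounded.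
have bV : bounded_by V (1 - r ^+ 2)^-1 by exact: ell2_op_bounded.
have bW : bounded_by W (neumann_cst (r ^+ 2)).
  split.
  - move=> c x y; apply: (@moebius_uniq (c *: x + y)); first exact: WP.
    move=> i; rewrite [RHS](_ : _ = c * x i + y i)// -(WP x) -(WP y).
    rewrite [X in X + _ = _](_ : _ = c * W x i + W y i)//.
    rewrite (local_linear (lop_local lop_C) i c); ring.
  - exact: neumann_cst_ge0 lop_K.
  - by move=> x; apply: neumann_bound lop_K rr1 _ _ _; exact: WP.
have bU : bounded_by (fun x => V ((fun y => C y + A y) (W (E x)))) _ :=
  bounded_by_comp bV (bounded_by_comp (bounded_by_add bC bA) (bounded_by_comp bW bE)).
exists A, C, (fun x => V ((fun y => C y + A y) (W (E x)))); split.
- split; first exact: bounded_by_op bA.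
  apply/funext => i; apply/funext => j; rewrite /op_matrix l2dot_unit /=.
  by rewrite /dg /mx_diag; case: eqVneq => // _; rewrite ?mulr1 ?mulr0.
- split; first exact: bounded_by_op bC.
  apply/funext => i; apply/funext => j; rewrite /op_matrix l2dot_unit /=.
  exact: cmv_matrix.
- have sqrtE (B B' : ell2 R -> ell2 R) : (forall x i, B (B' x) i = alpha i * (alpha i)^* * x i) ->
      is_sqrt l2dot (fun x => x - B (B' x)) E.
    move=> BB; split; first exact: bounded_by_op bE.
      move=> x; apply: l2dot_ge0 => i /=; rewrite /dg mulrCA mulr_ge0//.
        exact/ltW/eta_gt0.
      by rewrite mulrC mul_conjC_ge0.
    move=> x; apply: ell2_ext => i.
    rewrite [LHS](_ : _ = eta i * (eta i * x i))// mulrA eta_sqr.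
    by rewrite [RHS](_ : _ = x i - B (B' x) i)// BB mulrBl mul1r.
  split.
  + exact: bounded_by_op bA.
  + by rewrite (le_lt_trans (opnorm_le bA))// lte_fin sqrtr_sqr ger0_norm.
  + exact: bounded_by_op bC.
  + by rewrite (le_trans (opnorm_le bC))// sqrtr1.
  exists Ad, E, E, V, W; split => //.
  + split; first exact: bounded_by_op bAd.
    move=> x y; rewrite /l2dot; congr csum; apply/funext => i /=.
    by rewrite /dg /aconj rmorphM/= conjCK mulrCA mulrA.
  + split; apply: sqrtE => x i /=; rewrite /dg /aconj !mulrA//.
    by rewrite [_^* * _]mulrC.
  + split; first exact: bounded_by_op bV.
      by move=> x; apply: ell2_ext => i /=; rewrite /dg mulKf// eta_neq0.
    by move=> x; apply: ell2_ext => i /=; rewrite /dg mulVKf// eta_neq0.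
  + split; first exact: bounded_by_op bW.
      move=> x; apply: (@moebius_uniq (x + Ad (C x))); first exact: WP.
      by [].
    by move=> x; apply: ell2_ext => i; exact: WP.
- exact: bounded_by_op bU.
- move=> j; exists (W (E (l2unit j))); split => i; first exact: WP.
  by [].
Qed.

End MoebiusTransform.

(** * Square integrable functions on the circle *)

Section CircleMeasurable.
Context {R : realType}.
Implicit Types f g : circle R -> R[i].

Definition cmeas f : Prop :=
  measurable_fun [set: circle_borel R] (fun z => complex.Re (f z)) /\
  measurable_fun [set: circle_borel R] (fun z => complex.Im (f z)).

(** [F] is to be Re or Im; the two conditions make it 1-Lipschitz. *)
Lemma open_part_gt (F : R[i] -> R) (t : R) :
  (forall z, `|F z| <= cmod z) -> (forall z w, F (z - w) = F z - F w) ->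
  open [set z : R[i]^o | t < F z].
Proof.
move=> Fle FB; rewrite openE => z /= tz; apply/nbhs_ballP.
have tz0 : 0 < F z - t by rewrite subr_gt0.
(* Radii of balls in [R[i]^o] are themselves elements of R[i]. *)
exists (F z - t)%:C%C; first by rewrite /= ltcR.
move=> w; rewrite -ball_normE /= cmodE ltcR => zw.
have : F z - F w < F z - t.
  by rewrite -FB (le_lt_trans (ler_norm _))// (le_lt_trans (Fle _)).
by rewrite ltrD2l ltrN2.
Qed.

Lemma open_circle_measurable (V : set R[i]^o) : open V ->
  measurable ([set z | V (circle_val z)] : set (circle_borel R)).
Proof. by move=> oV; apply: sub_sigma_algebra; exists V. Qed.

Lemma cmeas_val : cmeas (@circle_val R).
Proof.
suff H (F : R[i] -> R) : (forall z, `|F z| <= cmod z) -> (forall z w, F (z - w) = F z - F w) ->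
    measurable_fun [set: circle_borel R] (fun z => F (circle_val z)).
  by split; apply: H => // [z|[? ?] [? ?]]//; [exact: Re_le_cmod|exact: Im_le_cmod].
move=> Fle FB _; apply: (measurability _ (RGenOInfty.measurableE R)) => //.
move=> /= _ [_ [t ->] <-]; rewrite setTI.
rewrite (_ : _ @^-1` _ = [set z | [set w : R[i]^o | t < F w] (circle_val z)]); last first.
  by apply/seteqP; split => z /=; rewrite in_itv/= andbT.
by apply: open_circle_measurable; exact: open_part_gt.
Qed.

Lemma cmeas_cst c : cmeas (fun=> c).
Proof. by split; exact: measurable_cst. Qed.

Lemma cmeasD f g : cmeas f -> cmeas g -> cmeas (fun z => f z + g z).
Proof.
move=> [mf mf'] [mg mg']; split.
- by under eq_fun do rewrite ReD; exact: measurable_funD.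
- by under eq_fun do rewrite ImD; exact: measurable_funD.
Qed.

Lemma cmeasM f g : cmeas f -> cmeas g -> cmeas (fun z => f z * g z).
Proof.
move=> [mf mf'] [mg mg']; split.
- by under eq_fun do rewrite ReM; apply: measurable_funB; exact: measurable_funM.
- by under eq_fun do rewrite ImM; apply: measurable_funD; exact: measurable_funM.
Qed.

Lemma cmeasJ f : cmeas f -> cmeas (fun z => (f z)^*).
Proof.
move=> [mf mf']; split.
- by under eq_fun do rewrite ReJ.
- by under eq_fun do rewrite ImJ; exact: measurable_funN.
Qed.

Lemma cmeasB f g : cmeas f -> cmeas g -> cmeas (fun z => f z - g z).
Proof.
move=> mf mg; rewrite (_ : (fun _ => _) = (fun z => f z + (-1) * g z)).
  by apply: cmeasD => //; apply: cmeasM => //; exact: cmeas_cst.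
by apply/funext => z; rewrite mulN1r.
Qed.

Lemma cmeas_prod (s : seq nat) (f : nat -> circle R -> R[i]) : (forall k, cmeas (f k)) ->
  cmeas (fun z => \prod_(k <- s) f k z).
Proof.
move=> mf; elim: s => [|k s IH].
  by under [X in cmeas X]funext do rewrite big_nil; exact: cmeas_cst.
rewrite (_ : (fun _ => _) = (fun z => f k z * \prod_(k <- s) f k z)).
  exact: cmeasM.
by apply/funext => z; rewrite big_cons.
Qed.

Lemma cmeas_sqr f : cmeas f ->
  measurable_fun [set: circle_borel R] (fun z => cmod (f z) ^+ 2).
Proof.
move=> [mf mf']; under eq_fun do rewrite cmod_sqr.
by apply: measurable_funD; exact: measurable_funX.
Qed.

(** The inverse is written as a real power of exponent -1, which is measurable on the whole line and
    agrees with it at 0 too. *)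
Lemma measurable_inv_ge0 (h : circle R -> R) : (forall z, 0 <= h z) ->
  measurable_fun [set: circle_borel R] h ->
  measurable_fun [set: circle_borel R] (fun z => (h z)^-1).
Proof.
move=> h0 mh; under eq_fun do rewrite -powR_inv1//.
exact: (measurableT_comp (@measurable_powR R (-1)) mh).
Qed.

Lemma cmeasV f : cmeas f -> cmeas (fun z => (f z)^-1).
Proof.
move=> mf; rewrite (_ : (fun _ => _) = (fun z => (f z)^* *
    Complex (cmod (f z) ^+ 2)^-1 0)).
  apply: cmeasM; first exact: cmeasJ.
  split => /=; last exact: measurable_cst.
  apply: (@measurable_inv_ge0 (fun z => cmod (f z) ^+ 2)) => [z|]; [exact: sqr_ge0|exact: cmeas_sqr].
apply/funext => z; rewrite cmod_sqr; case: (f z) => x y; rewrite /=.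
by apply: complex_ext => /=; rewrite ?mulr0 ?mul0r ?subr0 ?addr0 ?add0r//; lra.
Qed.

Lemma cmeasZ c f : cmeas f -> cmeas (fun z => c * f z).
Proof. by apply: cmeasM; exact: cmeas_cst. Qed.

End CircleMeasurable.

Section L2Space.
Context {R : realType} (mu : probability (circle_borel R) R).
Implicit Types f g h : circle R -> R[i].

Definition Rint (u : circle R -> R) : Prop :=
  mu.-integrable [set: circle_borel R] (fun z => (u z)%:E).

Lemma Rint_dom (u v : circle R -> R) :
  measurable_fun [set: circle_borel R] u -> Rint v ->
  (forall z, `|u z| <= v z) -> Rint u.
Proof.
move=> mu_ iv uv; apply: le_integrable iv => //; first exact/measurable_EFinP.
by move=> z _ /=; rewrite lee_fin (le_trans (uv z))// ler_norm.
Qed.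

Lemma RintD (u v : circle R -> R) : Rint u -> Rint v -> Rint (fun z => u z + v z).
Proof. by move=> iu iv; exact: (integrableD _ iu iv). Qed.

Lemma RintZ c (u : circle R -> R) : Rint u -> Rint (fun z => c * u z).
Proof. by move=> iu; exact: (integrableZl _ c iu). Qed.

Lemma Rint_cst c : Rint (fun=> c).
Proof. exact: finite_measure_integrable_cst. Qed.

Lemma L2_sqr f : L2 mu f -> Rint (fun z => cmod (f z) ^+ 2).
Proof.
move=> [mf mf' foo]; apply/integrableP; split.
  by apply/measurable_EFinP; exact: cmeas_sqr.
by under eq_integral => z _ do rewrite gee0_abs ?lee_fin ?sqr_ge0//.
Qed.

Lemma L2_cmeas f : L2 mu f -> cmeas f.
Proof. by case. Qed.

Lemma L2_dom f (v : circle R -> R) : cmeas f -> Rint v ->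
  (forall z, cmod (f z) ^+ 2 <= v z) -> L2 mu f.
Proof.
move=> mf iv fv; case: (mf) => mf1 mf2; split => //.
have /integrableP[_] : Rint (fun z => cmod (f z) ^+ 2).
  apply: Rint_dom iv _; first exact: cmeas_sqr.
  by move=> z; rewrite ger0_norm ?sqr_ge0.
by under eq_integral => z _ do rewrite gee0_abs ?lee_fin ?sqr_ge0//.
Qed.

Lemma L2_bounded f c : cmeas f -> (forall z, cmod (f z) <= c) -> L2 mu f.
Proof.
move=> mf fc; apply: (L2_dom mf (Rint_cst (c ^+ 2))) => z.
by rewrite ler_sqr ?nnegrE ?(le_trans (cmod_ge0 _) (fc z))// cmod_ge0.
Qed.

Lemma L2M f g c : cmeas f -> (forall z, cmod (f z) <= c) -> L2 mu g ->
  L2 mu (fun z => f z * g z).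
Proof.
move=> mf fc Lg; apply: (@L2_dom _ (fun z => c ^+ 2 * cmod (g z) ^+ 2)).
- exact: cmeasM mf (L2_cmeas Lg).
- by apply: RintZ; exact: L2_sqr.
- move=> z; rewrite cmodM exprMn ler_wpM2r ?sqr_ge0//.
  by rewrite ler_sqr ?nnegrE ?(le_trans (cmod_ge0 _) (fc z))// cmod_ge0.
Qed.

Lemma L2Z c f : L2 mu f -> L2 mu (fun z => c * f z).
Proof. by apply: (@L2M _ _ (cmod c)) => //; exact: cmeas_cst. Qed.

Lemma L2D f g : L2 mu f -> L2 mu g -> L2 mu (fun z => f z + g z).
Proof.
move=> Lf Lg.
apply: (@L2_dom _ (fun z => 2 * (cmod (f z) ^+ 2 + cmod (g z) ^+ 2))).
- exact: cmeasD (L2_cmeas Lf) (L2_cmeas Lg).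
- by apply: RintZ; apply: RintD; exact: L2_sqr.
- by move=> z; exact: cmod_sqrD2.
Qed.

Lemma L2B f g : L2 mu f -> L2 mu g -> L2 mu (fun z => f z - g z).
Proof.
move=> Lf Lg; rewrite (_ : (fun _ => _) = (fun z => f z + (-1) * g z)).
  by apply: L2D => //; exact: L2Z.
by apply/funext => z; rewrite mulN1r.
Qed.

Lemma L2_0 : L2 mu (fun=> 0).
Proof.
by apply: (@L2_bounded _ 0) => [|z]; [exact: cmeas_cst|rewrite cmod0].
Qed.

Lemma L2_sum n (f : nat -> circle R -> R[i]) : (forall k, L2 mu (f k)) ->
  L2 mu (fun z => \sum_(k < n) f k z).
Proof.
move=> Lf; elim: n => [|n IH].
  by under [X in L2 mu X]funext do rewrite big_ord0; exact: L2_0.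
rewrite (_ : (fun _ => _) = (fun z => \sum_(k < n) f k z + f n z)).
  exact: L2D.
by apply/funext => z; rewrite big_ord_recr.
Qed.

Definition cint f : Prop :=
  Rint (fun z => complex.Re (f z)) /\ Rint (fun z => complex.Im (f z)).

Lemma cint_dom f (v : circle R -> R) : cmeas f -> Rint v ->
  (forall z, cmod (f z) <= v z) -> cint f.
Proof.
move=> [mf mf'] iv fv; split; apply: Rint_dom iv _ => // z.
- exact: le_trans (Re_le_cmod _) (fv z).
- exact: le_trans (Im_le_cmod _) (fv z).
Qed.

Lemma cint_L2 f g : L2 mu f -> L2 mu g -> cint (fun z => (f z)^* * g z).
Proof.
move=> Lf Lg; apply: (@cint_dom _ (fun z => cmod (f z) ^+ 2 + cmod (g z) ^+ 2)).
- by apply: cmeasM; [apply: cmeasJ|]; exact: L2_cmeas.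
- by apply: RintD; exact: L2_sqr.
- move=> z; rewrite cmodM cmod_conj.
  have := sqr_ge0 (cmod (f z) - cmod (g z)).
  have := mulr_ge0 (cmod_ge0 (f z)) (cmod_ge0 (g z)).
  nra.
Qed.

Lemma cintegralD f g : cint f -> cint g ->
  cintegral mu (fun z => f z + g z) = cintegral mu f + cintegral mu g.
Proof.
move=> [fR fI] [gR gI]; apply: complex_ext => /=.
- under eq_Rintegral do rewrite ReD; exact: RintegralD.
- under eq_Rintegral do rewrite ImD; exact: RintegralD.
Qed.

Lemma cintegralZ c f : cint f ->
  cintegral mu (fun z => c * f z) = c * cintegral mu f.
Proof.
move=> [fR fI]; apply: complex_ext; rewrite ?ReM ?ImM/=.
- under eq_Rintegral do rewrite ReM.
  rewrite RintegralB//; [|exact: RintZ|exact: RintZ].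
  by rewrite !RintegralZl.
- under eq_Rintegral do rewrite ImM.
  rewrite RintegralD//; [|exact: RintZ|exact: RintZ].
  by rewrite !RintegralZl.
Qed.

Lemma cintegralJ f : cint f -> cintegral mu (fun z => (f z)^*) = (cintegral mu f)^*.
Proof.
move=> [fR fI]; apply: complex_ext; rewrite ?ReJ ?ImJ/=.
- by under eq_Rintegral do rewrite ReJ.
- under eq_Rintegral do rewrite ImJ -mulN1r.
  by rewrite RintegralZl// mulN1r.
Qed.

Lemma eq_L2dot f f' g g' : f =1 f' -> g =1 g' -> L2dot mu f g = L2dot mu f' g'.
Proof. by move=> /funext -> /funext ->. Qed.

Lemma L2dotD f g h : L2 mu f -> L2 mu g -> L2 mu h ->
  L2dot mu f (fun z => g z + h z) = L2dot mu f g + L2dot mu f h.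
Proof.
move=> Lf Lg Lh; rewrite /L2dot -cintegralD; [|exact: cint_L2..].
by congr cintegral; apply/funext => z; rewrite mulrDr.
Qed.

Lemma L2dotZ c f g : L2 mu f -> L2 mu g ->
  L2dot mu f (fun z => c * g z) = c * L2dot mu f g.
Proof.
move=> Lf Lg; rewrite /L2dot -cintegralZ; last exact: cint_L2.
by congr cintegral; apply/funext => z; rewrite mulrCA.
Qed.

Lemma L2dotJ f g : L2 mu f -> L2 mu g -> (L2dot mu f g)^* = L2dot mu g f.
Proof.
move=> Lf Lg; rewrite /L2dot -cintegralJ; last exact: cint_L2.
by congr cintegral; apply/funext => z; rewrite rmorphM/= conjCK mulrC.
Qed.

Lemma L2dot_sum n f (c : nat -> R[i]) (g : nat -> circle R -> R[i]) :
  L2 mu f -> (forall k, L2 mu (g k)) ->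
  L2dot mu f (fun z => \sum_(k < n) c k * g k z) = \sum_(k < n) c k * L2dot mu f (g k).
Proof.
move=> Lf Lg; elim: n => [|n IH].
  rewrite big_ord0 -[RHS](mul0r (L2dot mu f f)) -L2dotZ//.
  by apply: eq_L2dot => // z; rewrite big_ord0 mul0r.
rewrite big_ord_recr/= -IH -L2dotZ// -L2dotD//.
- by apply: eq_L2dot => // z; rewrite big_ord_recr.
- by apply: (@L2_sum n (fun k z => c k * g k z)) => k; exact: L2Z.
- exact: L2Z.
Qed.

Definition sqL f : R := \int[mu]_z (cmod (f z) ^+ 2).

Lemma L2dot_sqL f : L2dot mu f f = (sqL f)%:C%C.
Proof.
apply: complex_ext => /=.
- by apply: eq_Rintegral => z _; rewrite cmod_sqrE.
- rewrite -[RHS](mul0r (fine (mu setT))) -Rintegral_cst//.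
  by apply: eq_Rintegral => z _; rewrite cmod_sqrE.
Qed.

Lemma L2normE f : L2norm mu f = Num.sqrt (sqL f).
Proof. by rewrite /L2norm L2dot_sqL. Qed.

Lemma sqL_ge0 f : 0 <= sqL f.
Proof. by apply: Rintegral_ge0 => z _; exact: sqr_ge0. Qed.

Lemma sqL_le (f : circle R -> R[i]) (v : circle R -> R) : L2 mu f -> Rint v ->
  (forall z, cmod (f z) ^+ 2 <= v z) -> sqL f <= \int[mu]_z v z.
Proof. by move=> /L2_sqr Lf iv fv; apply: le_Rintegral. Qed.

Lemma sqLD f g : L2 mu f -> L2 mu g ->
  sqL (fun z => f z + g z) <= 2 * (sqL f + sqL g).
Proof.
move=> Lf Lg; have [iF iG] := (L2_sqr Lf, L2_sqr Lg).
rewrite /sqL -RintegralD// -RintegralZl//; last exact: RintD.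
apply: sqL_le; first exact: L2D.
- by apply: RintZ; exact: RintD.
- by move=> z; exact: cmod_sqrD2.
Qed.

Lemma sqLM f g c : cmeas f -> (forall z, cmod (f z) <= c) -> L2 mu g ->
  sqL (fun z => f z * g z) <= c ^+ 2 * sqL g.
Proof.
move=> mf fc Lg; have iG := L2_sqr Lg.
rewrite /sqL -RintegralZl//; apply: sqL_le; first exact: L2M mf fc Lg.
- exact: RintZ.
- move=> z; rewrite cmodM exprMn ler_wpM2r ?sqr_ge0//.
  by rewrite ler_sqr ?nnegrE ?(le_trans (cmod_ge0 _) (fc z))// cmod_ge0.
Qed.

Lemma sqLZ c f : L2 mu f -> sqL (fun z => c * f z) <= cmod c ^+ 2 * sqL f.
Proof. by apply: sqLM => //; exact: cmeas_cst. Qed.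

(** Bessel's inequality for one unit vector: the squared norm of g - c f is that of g minus |c|^2.
    It turns L^2 errors into errors on matrix entries. *)
Lemma L2dot_bound f g : L2 mu f -> L2 mu g -> sqL f = 1 ->
  cmod (L2dot mu f g) ^+ 2 <= sqL g.
Proof.
move=> Lf Lg f1; set c := L2dot mu f g.
have Lcf := L2Z (- c) Lf.
have := sqL_ge0 (fun z => g z + (- c) * f z).
have Lh : L2 mu (fun z => g z + (- c) * f z) by exact: L2D.
have : L2dot mu (fun z => g z + (- c) * f z) (fun z => g z + (- c) * f z) =
    (sqL g - cmod c ^+ 2)%:C%C.
  rewrite L2dotD// L2dotZ// -(L2dotJ Lg Lh) -(L2dotJ Lf Lh) !L2dotD// !L2dotZ//.
  rewrite -(L2dotJ Lf Lg) !L2dot_sqL f1 -/c.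
  rewrite [RHS]rmorphB/= -cmod_sqrE !(rmorphD, rmorphM, rmorphN, rmorph1)/= !conjCK.
  rewrite (_ : ((sqL g)%:C%C)^* = (sqL g)%:C%C); last first.
    by apply: geC0_conj; rewrite lecR sqL_ge0.
  ring.
by rewrite L2dot_sqL => /complexI -> ; rewrite subr_ge0.
Qed.

Section Closure.
Context (chi : nat -> circle R -> R[i]).
Hypothesis L2chi : forall k, L2 mu (chi k).

Definition combo n (c : nat -> R[i]) : circle R -> R[i] :=
  fun z => \sum_(k < n) c k * chi k z.

Lemma L2_combo n c : L2 mu (combo n c).
Proof. by apply: (@L2_sum n (fun k z => c k * chi k z)) => k; exact: L2Z. Qed.

(** The closed span K; [e] bounds a squared distance. *)
Definition in_closure g : Prop := L2 mu g /\
  forall e : R, 0 < e -> exists n c, sqL (fun z => g z - combo n c z) < e.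

Lemma combo_pad n m c : (n <= m)%N ->
  combo n c = combo m (fun k => if (k < n)%N then c k else 0).
Proof.
move=> nm; apply/funext => z; rewrite /combo.
rewrite (big_ord_widen m (fun k => c k * chi k z) nm) big_mkcond/=.
by apply: eq_bigr => k _; case: ifP => //; rewrite mul0r.
Qed.

Lemma comboD n c d z : combo n c z + combo n d z = combo n (fun k => c k + d k) z.
Proof. by rewrite /combo -big_split/=; apply: eq_bigr => k _; rewrite mulrDl. Qed.

Lemma comboZ n a c z : a * combo n c z = combo n (fun k => a * c k) z.
Proof. by rewrite /combo mulr_sumr; apply: eq_bigr => k _; rewrite mulrA. Qed.

Lemma in_closure_approx g : L2 mu g ->
  (forall e, 0 < e -> exists2 h, in_closure h & sqL (fun z => g z - h z) < e) ->
  in_closure g.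
Proof.
(* Adding two errors costs the factor 2 of [sqLD], so each is taken below e/4. *)
move=> Lg H; split => // e e0; have e4 : 0 < e / 4 by rewrite divr_gt0.
have [h [Lh hK] gh] := H _ e4; have [n [c hc]] := hK _ e4.
exists n, c; rewrite (_ : (fun _ => _) = fun z => (g z - h z) + (h z - combo n c z)).
  apply: le_lt_trans (sqLD _ _) _; [exact: L2B|by apply: L2B => //; exact: L2_combo|].
  by move: gh hc; lra.
by apply/funext => z; rewrite addrA subrK.
Qed.

Lemma in_closure_combo n c : in_closure (combo n c).
Proof.
split; first exact: L2_combo.
move=> e e0; exists n, c; rewrite (_ : (fun _ => _) = fun=> 0).
  by rewrite /sqL Rintegral_cst// cmod0 expr0n mul0r.
by apply/funext => z; rewrite subrr.
Qed.

Lemma in_closureD f g : in_closure f -> in_closure g ->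
  in_closure (fun z => f z + g z).
Proof.
move=> [Lf fK] [Lg gK]; split; first exact: L2D.
move=> e e0; have e4 : 0 < e / 4 by rewrite divr_gt0.
have [n [c fc]] := fK _ e4; have [m [d gd]] := gK _ e4.
have {fc}[c' fc] : exists c', sqL (fun z => f z - combo (maxn n m) c' z) < e / 4.
  by exists (fun k => if (k < n)%N then c k else 0); rewrite -(combo_pad c (leq_maxl n m)).
have {gd}[d' gd] : exists d', sqL (fun z => g z - combo (maxn n m) d' z) < e / 4.
  by exists (fun k => if (k < m)%N then d k else 0); rewrite -(combo_pad d (leq_maxr n m)).
exists (maxn n m), (fun k => c' k + d' k).
rewrite (_ : (fun _ => _) = fun z => (f z - combo (maxn n m) c' z) + (g z - combo (maxn n m) d' z)).
  by apply: le_lt_trans (sqLD _ _) _; [apply: L2B => //; exact: L2_combo..|move: fc gd; lra].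
by apply/funext => z; rewrite -comboD opprD addrACA.
Qed.

(** A bounded factor need only be tested on the [chi k]: finite combinations follow by linearity,
    limits by boundedness. *)
Lemma in_closureM m c : cmeas m -> (forall z, cmod (m z) <= c) ->
  (forall k, in_closure (fun z => m z * chi k z)) ->
  forall f, in_closure f -> in_closure (fun z => m z * f z).
Proof.
move=> mm mc mchi f [Lf fK]; apply: in_closure_approx; first exact: L2M mm mc Lf.
(* Adding 1 keeps the divisor positive when c = 0. *)
move=> e e0; have c0 : 0 < c ^+ 2 + 1 by rewrite ltr_wpDl ?sqr_ge0.
have [n [d fd]] := fK _ (divr_gt0 e0 c0).
exists (fun z => m z * combo n d z); last first.
  rewrite (_ : (fun _ => _) = fun z => m z * (f z - combo n d z)); last first.
    by apply/funext => z; rewrite mulrBr.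
  have Lfd : L2 mu (fun z => f z - combo n d z) by apply: L2B => //; exact: L2_combo.
  apply: le_lt_trans (sqLM mm mc Lfd) _; rewrite ltr_pdivlMr// in fd.
  apply: le_lt_trans fd; rewrite mulrC; apply: ler_wpM2l; first exact: sqL_ge0.
  by rewrite lerDl.
rewrite /combo; elim: n {fd} => [|n IH].
  rewrite (_ : (fun _ => _) = combo 0 d); first exact: in_closure_combo.
  by apply/funext => z; rewrite /combo !big_ord0 mulr0.
rewrite (_ : (fun _ => _) = fun z => m z * (\sum_(k < n) d k * chi k z) + d n * (m z * chi n z)).
  apply: in_closureD => //.
  (* The scalar multiple is treated directly, since [in_closureZ] is itself deduced from this
     lemma. *)
  have [Lg gK] := mchi n; split; first exact: L2Z.
  move=> e' e'0; have d0 : 0 < cmod (d n) ^+ 2 + 1 by rewrite ltr_wpDl ?sqr_ge0.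
  have [p [b gb]] := gK _ (divr_gt0 e'0 d0).
  exists p, (fun k => d n * b k).
  rewrite (_ : (fun _ => _) = fun z => d n * (m z * chi n z - combo p b z)).
    apply: le_lt_trans (sqLZ _ _) _; first by apply: L2B => //; exact: L2_combo.
    rewrite ltr_pdivlMr// in gb; apply: le_lt_trans gb; rewrite mulrC.
    by apply: ler_wpM2l; [exact: sqL_ge0|rewrite lerDl].
  by apply/funext => z; rewrite -comboZ mulrBr.
by apply/funext => z; rewrite big_ord_recr/= mulrDr mulrCA.
Qed.

Lemma in_closure_chi k : in_closure (chi k).
Proof.
rewrite (_ : chi k = combo k.+1 (fun j => (j == k)%:R)).
  exact: in_closure_combo.
apply/funext => z; rewrite /combo big_ord_recr/= eqxx mul1r big1 ?add0r// => j _.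
by rewrite ltn_eqF// mul0r.
Qed.

Lemma in_closureZ a f : in_closure f -> in_closure (fun z => a * f z).
Proof.
apply: (@in_closureM (fun=> a) (cmod a)) => // k.
rewrite (_ : (fun _ => _) = combo k.+1 (fun j => a * (j == k)%:R)).
  exact: in_closure_combo.
apply/funext => z; rewrite /combo big_ord_recr/= eqxx mulr1 big1 ?add0r// => j _.
by rewrite ltn_eqF// mulr0 mul0r.
Qed.

Hypothesis chi_on : Defs.orthonormal (L2dot mu) chi.

Lemma sqL_combo n c : sqL (combo n c) = \sum_(k < n) cmod (c k) ^+ 2.
Proof.
apply: (@complexI R); rewrite -L2dot_sqL rmorph_sum/= L2dot_sum//; last exact: L2_combo.
apply: eq_bigr => k _; rewrite -L2dotJ//; last exact: L2_combo.
rewrite L2dot_sum// (bigD1 k)//= chi_on eqxx mulr1 big1 ?addr0; last first.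
  by move=> j jk; rewrite chi_on eq_sym -val_eqE/= in jk *; rewrite (negbTE jk) mulr0.
by rewrite mulrC cmod_sqrE.
Qed.

Lemma L2dot_combo n c i : (i < n)%N -> L2dot mu (chi i) (combo n c) = c i.
Proof.
move=> ni; rewrite L2dot_sum// (bigD1 (Ordinal ni))//= chi_on eqxx mulr1.
rewrite big1 ?addr0// => j; rewrite -val_eqE/= => jk.
by rewrite chi_on eq_sym (negbTE jk) mulr0.
Qed.

End Closure.
End L2Space.

(** * Density from invariance under multiplication by z and its conjugate *)

(* The iterates of this polynomial map converge boundedly to the sign function
   on [-1, 1]; they turn a bounded multiplier m into the indicator of m > 0. *)
Definition sgn_step {R : realType} (x : R) : R := (3 * x - x ^+ 3) / 2.

(** One step increases s in [0, 1], and it multiplies 1 - s by (1 - s)(2 + s)/2 <= 1 - s/2 <= 1 -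
    u/2 as long as s >= u. *)
Lemma iter_sgn_step_pos {R : realType} (u : R) n : 0 < u <= 1 ->
  u <= iter n sgn_step u <= 1 /\ 1 - iter n sgn_step u <= (1 - u / 2) ^+ n.
Proof.
case/andP=> u0 u1; elim: n => [|n [/andP[us s1] sn]].
  by rewrite /= lexx u1 expr0 gerBl ltW.
rewrite iterS; set s := iter n sgn_step u in us s1 sn *.
have s0 : 0 <= s by rewrite ltW// (lt_le_trans u0).
have e1 : 1 - sgn_step s = (1 - s) * ((1 - s) * (2 + s) / 2).
  by rewrite /sgn_step; field.
have e2 : sgn_step s - s = s * (1 - s) * (1 + s) / 2 by rewrite /sgn_step; field.
have h1 : 0 <= 1 - sgn_step s by rewrite e1; repeat apply: mulr_ge0 => //; lra.
have h2 : 0 <= sgn_step s - s by rewrite e2; repeat apply: mulr_ge0 => //; lra.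
split; first by apply/andP; split; lra.
rewrite e1 exprSr; apply: ler_pM => //; [lra|by repeat apply: mulr_ge0 => //; lra|].
have : 0 <= s * s by exact: mulr_ge0.
nra.
Qed.

Lemma iter_sgn_step_opp {R : realType} (u : R) n :
  iter n sgn_step (- u) = - iter n sgn_step u.
Proof.
elim: n => // n IH; rewrite !iterS IH /sgn_step.
by set s := iter n sgn_step u; field.
Qed.

Lemma iter_sgn_step0 {R : realType} n : iter n sgn_step (0 : R) = 0.
Proof.
by elim: n => // n IH; rewrite iterS IH /sgn_step mulr0 expr0n subr0 mul0r.
Qed.

Lemma iter_sgn_step_cvg {R : realType} (u : R) : `|u| <= 1 ->
  iter n sgn_step u @[n --> \oo] --> Num.sg u.
Proof.
have H (v : R) : 0 < v <= 1 -> iter n sgn_step v @[n --> \oo] --> (1 : R).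
  move=> v01; have [v0 v1] := andP v01.
  apply: (@squeeze_cvgr _ _ _ _ (fun n => 1 - (1 - v / 2) ^+ n) (fun=> 1)).
  - apply: nearW => n; have [/andP[_ s1] sn] := iter_sgn_step_pos n v01.
    by rewrite s1 andbT lerBlDr addrC -lerBlDr.
  - rewrite -[X in _ --> X]subr0; apply: cvgB; first exact: cvg_cst.
    by apply: cvg_expr; rewrite ger0_norm; lra.
  - exact: cvg_cst.
move=> u1; have [u0|u0|->] := ltrgtP u 0.
- rewrite ltr0_sg// -[u]opprK; under eq_fun do rewrite iter_sgn_step_opp.
  by apply: cvgN; apply: H; rewrite -ltr0_norm// u1 normr_gt0 lt_eqF.
- by rewrite gtr0_sg//; apply: H; rewrite u0 -(gtr0_norm u0).
- by rewrite sgr0; under eq_fun do rewrite iter_sgn_step0; exact: cvg_cst.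
Qed.

Section Multipliers.
Import HBSimple HBNNSimple.
Context {R : realType} (mu : probability (circle_borel R) R).
Context (chi : nat -> circle R -> R[i]).
Hypothesis L2chi : forall k, L2 mu (chi k).

Local Notation K := (in_closure mu chi).

Lemma sqL_cvg0 (h : nat -> circle R -> R[i]) (v : circle R -> R) :
  (forall n, cmeas (h n)) -> Rint mu v ->
  (forall n z, cmod (h n z) ^+ 2 <= v z) ->
  (forall z, cmod (h n z) ^+ 2 @[n --> \oo] --> (0 : R)) ->
  forall e, 0 < e -> exists n, sqL mu (h n) < e.
Proof.
move=> mh iv hv h0 e e0.
have mh' n : measurable_fun [set: circle_borel R] (fun z => (cmod (h n z) ^+ 2)%:E).
  by apply/measurable_EFinP; exact: cmeas_sqr.
have h0' : {ae mu, forall z, [set: circle_borel R] z ->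
    (fun n => (cmod (h n z) ^+ 2)%:E) @ \oo --> cst 0%E z}.
  by apply: aeW => z _; apply: cvg_EFin; [exact: nearW|exact: h0].
have hv' : {ae mu, forall z n, [set: circle_borel R] z ->
    (`|(cmod (h n z) ^+ 2)%:E| <= (v z)%:E)%E}.
  by apply: aeW => z n _; rewrite lee_fin ger0_norm ?sqr_ge0.
have [_ _] := dominated_convergence measurableT mh' (measurable_cst _) h0' iv hv'.
rewrite integral0 => /fine_cvgP[_ /cvgrPdist_lt/(_ e e0)[N _ /(_ N (leqnn _))]].
rewrite /= sub0r normrN => H; exists N; apply: le_lt_trans H.
exact: ler_norm.
Qed.

(** Restricted to real functions so that their sign, and thus indicators, can be reached by
    [sgn_step]. *)
Definition multiplier (m : circle R -> R) : Prop :=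
  [/\ measurable_fun [set: circle_borel R] m,
      exists c, forall z, `|m z| <= c &
      forall f, K f -> K (fun z => (m z)%:C%C * f z)].

Lemma cmeas_real (m : circle R -> R) : measurable_fun [set: circle_borel R] m ->
  cmeas (fun z => (m z)%:C%C).
Proof. by move=> mm; split => //; exact: measurable_cst. Qed.

Lemma cmod_real (x : R) : cmod x%:C%C = `|x|.
Proof. by rewrite /cmod normc_def/= expr0n addr0 sqrtr_sqr. Qed.

Lemma mult_cst c : multiplier (fun=> c).
Proof.
split; first exact: measurable_cst.
  by exists (`|c|).
by move=> f; exact: in_closureZ.
Qed.

Lemma multD m m' : multiplier m -> multiplier m' ->
  multiplier (fun z => m z + m' z).
Proof.
move=> [mm [c mc] mK] [mm' [c' mc'] mK']; split.
- exact: measurable_funD.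
- by exists (c + c') => z; rewrite (le_trans (ler_normD _ _))// lerD.
- move=> f fK; rewrite (_ : (fun _ => _) = fun z => (m z)%:C%C * f z + (m' z)%:C%C * f z).
    by apply: in_closureD => //; [exact: mK|exact: mK'].
  by apply/funext => z; rewrite rmorphD/= mulrDl.
Qed.

Lemma multM m m' : multiplier m -> multiplier m' ->
  multiplier (fun z => m z * m' z).
Proof.
move=> [mm [c mc] mK] [mm' [c' mc'] mK']; split.
- exact: measurable_funM.
- by exists (c * c') => z; rewrite normrM ler_pM.
- move=> f fK; rewrite (_ : (fun _ => _) = fun z => (m z)%:C%C * ((m' z)%:C%C * f z)).
    exact/mK/mK'.
  by apply/funext => z; rewrite rmorphM/= mulrA.
Qed.

Lemma eq_multiplier m m' : m =1 m' -> multiplier m -> multiplier m'.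
Proof. by move=> /funext ->. Qed.

Lemma multZ c m : multiplier m -> multiplier (fun z => c * m z).
Proof. by apply: multM; exact: mult_cst. Qed.

Lemma multB m m' : multiplier m -> multiplier m' ->
  multiplier (fun z => m z - m' z).
Proof.
move=> mm mm'; apply: (@eq_multiplier (fun z => m z + (-1) * m' z)).
  by move=> z; rewrite mulN1r.
by apply: multD => //; exact: multZ.
Qed.

Lemma mult_sum n (m : nat -> circle R -> R) : (forall k, multiplier (m k)) ->
  multiplier (fun z => \sum_(k < n) m k z).
Proof.
move=> mm; elim: n => [|n IH].
  by apply: (eq_multiplier _ (mult_cst 0)) => z; rewrite big_ord0.
by apply: (eq_multiplier _ (multD IH (mm n))) => z; rewrite big_ord_recr.
Qed.

Lemma mult_lim (m : nat -> circle R -> R) (l : circle R -> R) c :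
  (forall n, multiplier (m n)) -> (forall n z, `|m n z| <= c) ->
  (forall z, m n z @[n --> \oo] --> l z) -> multiplier l.
Proof.
move=> mm mc ml.
have ml_meas : measurable_fun [set: circle_borel R] l.
  apply: (@measurable_fun_cvg _ (circle_borel R) R setT m l) => [n|z _];
    [by case: (mm n)|exact: ml].
have lc z : `|l z| <= c.
  apply: (cvgr_to_le (cvg_norm (ml z))); apply: nearW => n; exact: mc.
split => //; first by exists c.
move=> f fK; have [Lf _] := fK.
have lc' z : cmod (l z)%:C%C <= c by rewrite cmod_real.
have Llf := L2M (cmeas_real ml_meas) lc' Lf.
apply: in_closure_approx => // e e0.
pose h n z := (l z)%:C%C * f z - (m n z)%:C%C * f z.
have hE n z : cmod (h n z) ^+ 2 = (l z - m n z) ^+ 2 * cmod (f z) ^+ 2.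
  by rewrite /h -mulrBl -rmorphB cmodM cmod_real exprMn real_normK ?num_real.
(* Since |l - m_n| <= 2c, the squared errors are dominated by 4 c^2 |f|^2. *)
have [||||n hn] := @sqL_cvg0 h (fun z => (4 * c ^+ 2) * cmod (f z) ^+ 2) _ _ _ _ e e0.
- move=> n; apply: cmeasB; apply: cmeasM; [exact: cmeas_real|exact: L2_cmeas Lf
    |apply: cmeas_real; by case: (mm n)|exact: L2_cmeas Lf].
- by apply: RintZ; exact: L2_sqr.
- move=> n z; rewrite hE ler_wpM2r ?sqr_ge0//.
  have := lc z; have := mc n z; rewrite !ler_norml => /andP[? ?] /andP[? ?].
  rewrite -subr_ge0 (_ : _ - _ = (2 * c - (l z - m n z)) * (2 * c + (l z - m n z))).
    by apply: mulr_ge0; lra.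
  by ring.
- move=> z; under eq_fun do rewrite hE.
  rewrite -(mul0r (cmod (f z) ^+ 2)); apply: cvgM; last exact: cvg_cst.
  rewrite [X in _ --> X](_ : _ = (l z - l z) * (l z - l z)); last by rewrite subrr mul0r.
  under eq_fun do rewrite expr2.
  by apply: cvgM; apply: cvgB => //; exact: cvg_cst.
by exists (fun z => (m n z)%:C%C * f z) => //; case: (mm n) => _ _; exact.
Qed.

Lemma mult_gt0 m : multiplier m -> multiplier (fun z => (0 < m z)%R%:R).
Proof.
move=> mm; have [_ [c mc] _] := mm.
(* [c] is nonnegative because it bounds |m| at a point; dividing by c + 1 brings the values into
   [-1, 1]. *)
have c0 : 0 < c + 1 by rewrite ltr_wpDl// (le_trans _ (mc point)).
pose u z := (c + 1)^-1 * m z.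
have mu1 : multiplier u by exact: multZ.
have u1 z : `|u z| <= 1.
  rewrite normrM gtr0_norm ?invr_gt0// mulrC ler_pdivrMr// mul1r.
  by rewrite (le_trans (mc z))// lerDl.
have msg : multiplier (fun z => Num.sg (u z)).
  apply: (@mult_lim (fun n z => iter n sgn_step (u z)) _ 1).
  - elim=> [|n IH]; first exact: mu1.
    apply: (@eq_multiplier (fun z => 2^-1 * (3 * iter n sgn_step (u z) -
      iter n sgn_step (u z) * (iter n sgn_step (u z) * iter n sgn_step (u z))))).
      by move=> z; rewrite iterS /sgn_step; set s := iter _ _ _; field.
    exact (multZ (2^-1) (multB (multZ 3 IH) (multM IH (multM IH IH)))).
  - move=> n z; have H (v : R) : 0 < v <= 1 -> `|iter n sgn_step v| <= 1.
      move=> v01; have [/andP[v0 v1]] := iter_sgn_step_pos n v01.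
      by have [? _] := andP v01; rewrite ger0_norm//; lra.
    have := u1 z; have [u0|u0|->] := ltrgtP (u z) 0 => h.
    + rewrite -[u z]opprK iter_sgn_step_opp normrN H// oppr_gt0 u0/=.
      by rewrite -ltr0_norm.
    + by rewrite H// u0 -(gtr0_norm u0).
    + by rewrite iter_sgn_step0 normr0.
  - by move=> z; exact: iter_sgn_step_cvg.
(* For a sign s in {-1, 0, 1}, (s + s^2)/2 is 1 exactly when s = 1, and 0 otherwise. *)
apply: (@eq_multiplier (fun z => 2^-1 * (Num.sg (u z) + Num.sg (u z) * Num.sg (u z)))).
  move=> z; rewrite sgrM [Num.sg (_^-1)]gtr0_sg ?invr_gt0// mul1r.
  by have [_|_|_] := sgrP (m z) => /=; field.
exact (multZ (2^-1) (multD msg (multM msg msg))).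
Qed.

Definition mult_set : set (set (circle_borel R)) :=
  [set A : set (circle_borel R) | multiplier (fun z => (z \in A)%:R)].

Lemma mult_setU A B : mult_set A -> mult_set B -> mult_set (A `|` B).
Proof.
move=> mA mB.
apply: (@eq_multiplier (fun z => 1 - (1 - (z \in A)%:R) * (1 - (z \in B)%:R))).
  by move=> z; rewrite in_setU; case: (z \in A); case: (z \in B) => /=; ring.
exact: multB (mult_cst 1) (multM (multB (mult_cst 1) mA) (multB (mult_cst 1) mB)).
Qed.

(** Countable unions are limits of finite ones: at each point the indicators are eventually
    constant. *)
Lemma mult_set_sigma : sigma_algebra setT mult_set.
Proof.
split.
- by apply: (eq_multiplier _ (mult_cst 0)) => z; rewrite in_set0.
- move=> A mA; apply: (eq_multiplier _ (multB (mult_cst 1) mA)) => z.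
  by rewrite in_setD in_setT; case: (z \in A); rewrite /= ?subrr ?subr0.
- move=> F mF; pose G n := \big[setU/set0]_(i < n) F i.
  have mG n : mult_set (G n).
    rewrite /G; elim: n => [|n IH].
      rewrite big_ord0; apply: (eq_multiplier _ (mult_cst 0)) => z.
      by rewrite in_set0.
    by rewrite big_ord_recr; exact: mult_setU.
  apply: (@mult_lim (fun n z => (z \in G n)%:R) _ 1) => // [n z|z].
    by case: (z \in G n); rewrite ?normr1 ?normr0.
  apply: cvg_near_cst; have [zF|zF] := boolP (z \in \bigcup_k F k).
    have [k _ Fk] := set_mem zF; near=> n.
    rewrite mem_set// /G -bigcup_mkord; exists k => //=.
    by near: n; exists k.+1.
  apply: nearW => n; rewrite memNset// /G -bigcup_mkord => -[k _ Fk].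
  by move/negP: zF; apply; rewrite inE; exists k.
Unshelve. all: by end_near. Qed.

Hypothesis val_chi : forall k, K (fun z => circle_val z * chi k z).
Hypothesis conj_chi : forall k, K (fun z => (circle_val z)^* * chi k z).

Lemma cmod_circle (z : circle R) : cmod (circle_val z) = 1.
Proof.
case: z => z zP; rewrite /circle_val /set_val/=; move: (set_mem zP) => /= h.
by apply: (@complexI R); rewrite -cmodE h.
Qed.

Lemma closure_val f : K f -> K (fun z => circle_val z * f z).
Proof.
move=> fK; apply: (in_closureM L2chi (@cmeas_val R) (c := 1)) => // z.
by rewrite cmod_circle.
Qed.

Lemma closure_conj f : K f -> K (fun z => (circle_val z)^* * f z).
Proof.
move=> fK; apply: (in_closureM L2chi (cmeasJ (@cmeas_val R)) (c := 1)) => // z.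
by rewrite cmod_conj cmod_circle.
Qed.

Lemma mult_Re : multiplier (fun z => complex.Re (circle_val z)).
Proof.
split; first by case: (@cmeas_val R).
- by exists 1 => z; rewrite -(cmod_circle z) Re_le_cmod.
- move=> f fK; rewrite (_ : (fun _ => _) = fun z => (2^-1)%:C%C *
    (circle_val z * f z + (circle_val z)^* * f z)).
    by apply: in_closureZ => //; apply: in_closureD => //; [exact: closure_val|exact: closure_conj].
  apply/funext => z; rewrite -mulrDl mulrA; congr (_ * _).
  by case: (circle_val z) => x y; apply: complex_ext; rewrite /=; field.
Qed.

Lemma mult_Im : multiplier (fun z => complex.Im (circle_val z)).
Proof.
split; first by case: (@cmeas_val R).
- by exists 1 => z; rewrite -(cmod_circle z) Im_le_cmod.
- move=> f fK; rewrite (_ : (fun _ => _) = fun z => Complex 0 (- 2^-1) *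
    (circle_val z * f z + (-1) * ((circle_val z)^* * f z))).
    apply: in_closureZ => //; apply: in_closureD => //; first exact: closure_val.
    by apply: in_closureZ => //; exact: closure_conj.
  apply/funext => z; rewrite mulN1r -mulrBl mulrA; congr (_ * _).
  by case: (circle_val z) => x y; apply: complex_ext; rewrite /=; field.
Qed.

(** [p.2] is the squared radius: the ball is then the positivity set of a polynomial in Re z and Im
    z, within reach of [mult_gt0]. Rational parameters make the family countable. *)
Definition rat_ball (p : rat * rat * rat) : set (circle_borel R) :=
  [set z | 0 < ratr p.2 - cmod (circle_val z - Complex (ratr p.1.1) (ratr p.1.2)) ^+ 2].

Lemma mult_rat_ball p : mult_set (rat_ball p).
Proof.
have mb : multiplier (fun z => ratr p.2 -
    cmod (circle_val z - Complex (ratr p.1.1) (ratr p.1.2)) ^+ 2).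
  apply: multB; first exact: mult_cst.
  apply: (@eq_multiplier (fun z =>
    (complex.Re (circle_val z) - ratr p.1.1) * (complex.Re (circle_val z) - ratr p.1.1) +
    (complex.Im (circle_val z) - ratr p.1.2) * (complex.Im (circle_val z) - ratr p.1.2))).
    by move=> z; rewrite cmod_sqr ReD ImD ReN ImN/= !expr2.
  have mX := multB mult_Re (mult_cst (ratr p.1.1)).
  have mY := multB mult_Im (mult_cst (ratr p.1.2)).
  exact: multD (multM mX mX) (multM mY mY).
apply: (eq_multiplier _ (mult_gt0 mb)) => z.
by congr (nat_of_bool _)%:R; apply/idP/idP; rewrite inE.
Qed.

(** Second countability: an open set is the union of the countably many [rat_ball] sets that it
    contains. *)
Lemma mult_open (U : set (circle R)) : open U -> mult_set U.
Proof.
move=> [V oV VU].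
(* Numbers that code no triple, or a ball not inside [U], contribute the empty set. *)
pose F n : set (circle_borel R) := if unpickle n is Some p then
  (if pselect (rat_ball p `<=` U) then rat_ball p else set0) else set0.
have -> : (U : set (circle_borel R)) = \bigcup_n F n; last first.
  have [m0 _ mU] := mult_set_sigma; apply: mU => n; rewrite /F.
  case: (unpickle n) => [p|] //; case: (pselect (rat_ball p `<=` U)) => //= _.
  exact: mult_rat_ball.
apply/seteqP; split => [z Uz|z [n _]]; last first.
  by rewrite /F; case: (unpickle n) => [p|] //; case: (pselect (rat_ball p `<=` U)) => //= pU /pU.
have Vz : V (circle_val z) by move: Uz; rewrite -VU.
have /nbhs_ballP[e e0 eV] : nbhs (circle_val z : R[i]^o) V.
  by move: oV; rewrite openE; apply.
have [d d0 dV] : exists2 d : R, 0 < d &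
    forall w, cmod (circle_val z - w) ^+ 2 < d ^+ 2 -> V w.
  have eR : e = (complex.Re e)%:C%C.
    by apply: complex_ext => //=; move: e0; rewrite /= lt_def lecE/= => /and3P[_ /eqP].
  exists (complex.Re e) => [|w]; first by move: e0; rewrite /= {1}eR ltcR.
  move=> h; apply: eV; rewrite -ball_normE/= cmodE eR ltcR.
  rewrite -ltr_sqr// nnegrE ?cmod_ge0//.
  by move: e0; rewrite /= {1}eR ltcR => /ltW.
have d4 : 0 < d / 4 by rewrite divr_gt0.
have [p] : exists p, ratr p \in
    `]complex.Re (circle_val z) - d / 4, complex.Re (circle_val z) + d / 4[.
  by apply: rat_in_itvoo; lra.
have [q] : exists p, ratr p \in
    `]complex.Im (circle_val z) - d / 4, complex.Im (circle_val z) + d / 4[.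
  by apply: rat_in_itvoo; lra.
(* A centre within d/4 of z in both parts is at squared distance below d^2/8 < s, so z lies in the
   ball; any y in the ball then has |z - y|^2 <= 2 (d^2/8 + s) < d^2. *)
have [s] : exists p, (ratr p : R) \in `]d ^+ 2 / 8, d ^+ 2 / 4[.
  by apply: rat_in_itvoo; have := exprn_gt0 2 d0; lra.
rewrite !in_itv/= => /andP[s1 s2] /andP[q1 q2] /andP[p1 p2].
have zw : cmod (circle_val z - Complex (ratr p) (ratr q)) ^+ 2 < d ^+ 2 / 8.
  rewrite cmod_sqr ReD ImD ReN ImN/=.
  have h (x y : R) : x - d / 4 < y -> y < x + d / 4 -> (x - y) ^+ 2 < d ^+ 2 / 16.
    move=> xy yx; rewrite -subr_gt0 (_ : _ - _ = (d / 4 - (x - y)) * (d / 4 + (x - y))).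
      by apply: mulr_gt0; lra.
    by field.
  have := h _ _ p1 p2; have := h _ _ q1 q2; lra.
have zB : rat_ball (p, q, s) z by rewrite /rat_ball/=; lra.
exists (pickle (p, q, s)); first exact: I.
rewrite /F pickleK.
case: (pselect (rat_ball (p, q, s) `<=` U)) => //= -[]; move=> y; rewrite /rat_ball/= => yB.
rewrite -VU/=; apply: dV.
have := cmod_sqrD2 (circle_val z - Complex (ratr p) (ratr q))
  (- (circle_val y - Complex (ratr p) (ratr q))).
rewrite cmodN opprB subrKA; move: (cmod (circle_val z - _)) => ?.
by move: yB zw s1 s2 d0; lra.
Qed.

Lemma mult_borel (A : set (circle_borel R)) : measurable A -> mult_set A.
Proof.
(* Measurability here means membership in every sigma-algebra that contains the open sets;
   [mult_set] is one. *)
move=> mA; apply: mA; split; first exact: mult_set_sigma.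
exact: mult_open.
Qed.

Hypothesis one_closure : K (fun=> 1).

(** Simple functions t below g are combinations of indicators, hence multipliers, and applied to 1
    they land in K. Domination comes from (g - t)^2 <= g^2. *)
Lemma closure_ge0 (g : circle R -> R) : (forall z, 0 <= g z) ->
  measurable_fun [set: circle_borel R] g -> Rint mu (fun z => g z ^+ 2) ->
  K (fun z => (g z)%:C%C).
Proof.
move=> g0 mg ig.
have mg' : measurable_fun [set: circle_borel R] (fun z => (g z)%:E).
  exact/measurable_EFinP.
have g0' z : [set: circle_borel R] z -> (0 <= (g z)%:E)%E by rewrite lee_fin.
pose s n : {nnsfun circle_borel R >-> R} := nnsfun_approx measurableT mg' n.
pose t n : circle R -> R := (s n : circle_borel R -> R).
have ms n : multiplier (t n).
  have [N [v vE]] : exists N (v : nat -> R), forall z, s n z =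
      \sum_(i < N) v i * \1_(s n @^-1` [set v i]) z.
    by do 2 eexists; exact: (fimfunEord (s n)).
  apply: (@eq_multiplier (fun z => \sum_(i < N) v i * (z \in s n @^-1` [set v i])%:R)).
    by move=> z; rewrite /t vE; apply: eq_bigr => i _; rewrite indicE.
  apply: (@mult_sum _ (fun i z => v i * (z \in s n @^-1` [set v i])%:R)) => i.
  by apply: multZ; apply: mult_borel; exact: measurable_funPTI.
have sg n z : t n z <= g z.
  have := le_approx n g0' (I : [set: circle_borel R] z).
  by rewrite -nnsfun_approxE lee_fin /t.
have s0 n z : 0 <= t n z by exact: fun_ge0.
apply: in_closure_approx => //.
  apply: (L2_dom (cmeas_real mg) ig) => z.
  by rewrite cmod_real real_normK ?num_real.
move=> e e0.
have hE n z : cmod ((g z)%:C%C - (t n z)%:C%C * 1) ^+ 2 = (g z - t n z) ^+ 2.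
  by rewrite mulr1 -rmorphB cmod_real real_normK ?num_real.
have [||||n hn] := @sqL_cvg0 (fun n z => (g z)%:C%C - (t n z)%:C%C * 1)
    (fun z => g z ^+ 2) _ _ _ _ e e0.
- move=> n; apply: cmeasB; first exact: cmeas_real.
  by apply: cmeasM; [apply: cmeas_real; case: (ms n)|exact: cmeas_cst].
- exact: ig.
- by move=> n z; rewrite hE; have := sg n z; have := s0 n z; have := g0 z; nra.
- move=> z; rewrite (_ : (fun n => _) = (fun n => (g z - t n z) * (g z - t n z))); last first.
    by apply/funext => n; rewrite hE expr2.
  have gs : t n z @[n --> \oo] --> g z.
    by have /fine_cvgP[] := cvg_nnsfun_approx measurableT mg' g0' (I : [set: circle_borel R] z).
  rewrite [X in _ --> X](_ : _ = (g z - g z) * (g z - g z)); last by rewrite subrr mul0r.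
  by apply: cvgM; apply: cvgB => //; exact: cvg_cst.
by exists (fun z => (t n z)%:C%C * 1) => //; case: (ms n) => _ _; exact.
Qed.

Theorem closure_L2 g : L2 mu g -> K g.
Proof.
move=> Lg; have [mR mI _] := Lg.
have part (F : R[i] -> R) : measurable_fun [set: circle_borel R] (fun z => F (g z)) ->
    (forall w, `|F w| <= cmod w) -> K (fun z => (F (g z))%:C%C).
  move=> mF Fle.
  have H (u : circle R -> R) : measurable_fun [set: circle_borel R] u ->
      (forall z, `|u z| <= cmod (g z)) -> K (fun z => (Num.max (u z) 0)%:C%C).
    move=> mu_ ug; have mm : measurable_fun [set: circle_borel R] (fun z => Num.max (u z) 0).
      by apply: measurable_maxr => //; exact: measurable_cst.
    apply: closure_ge0 => //; first by move=> z; rewrite le_max lexx orbT.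
    apply: Rint_dom (L2_sqr Lg) _; first exact: measurable_funX.
    move=> z; rewrite ger0_norm ?sqr_ge0// ler_sqr ?nnegrE ?cmod_ge0 ?le_max ?lexx ?orbT//.
    by rewrite ge_max cmod_ge0 andbT (le_trans (ler_norm _)).
  rewrite (_ : (fun _ => _) = fun z => (Num.max (F (g z)) 0)%:C%C +
      (-1) * (Num.max (- F (g z)) 0)%:C%C).
    apply: in_closureD => //; first exact: H.
    apply: in_closureZ => //; apply: H; first exact: measurable_funN.
    by move=> z; rewrite normrN.
  apply/funext => z; rewrite mulN1r -rmorphB; congr (_%:C%C).
  by case: (leP (F (g z)) 0) => h; [rewrite max_l ?oppr_ge0//|rewrite max_r ?oppr_le0 ?ltW//]; ring.
rewrite (_ : g = fun z => (complex.Re (g z))%:C%C + Complex 0 1 * (complex.Im (g z))%:C%C).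
  apply: in_closureD => //; first by apply: part => //; exact: Re_le_cmod.
  by apply: in_closureZ => //; apply: part => //; exact: Im_le_cmod.
apply/funext => z; case: (g z) => x y.
by apply: complex_ext => /=; ring.
Qed.

End Multipliers.

(** * Orthonormality of the functions chi *)

Section ORFAlgebra.
Context {R : realType} (mu : probability (circle_borel R) R).
Context (alpha a : nat -> R[i]) (phi : nat -> R[i] -> R[i]).
Hypothesis alpha1 : forall n, `|alpha n| < 1.
Hypothesis phi_orf : is_orf mu alpha phi a.

Local Notation "x %:v" := (circle_val x) (at level 2, format "x %:v").
Implicit Types (x : circle R) (f g : circle R -> R[i]).

Lemma circle_conjM x : (x%:v)^* * x%:v = 1.
Proof. by rewrite cmod_sqrE cmod_circle expr1n. Qed.

Lemma circle_val_neq0 x : x%:v != 0.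
Proof.
by apply/eqP => x0; move/eqP: (circle_conjM x); rewrite x0 mulr0 eq_sym oner_eq0.
Qed.

(** The circle is fixed by z -> 1 / conj z, so there the reflection is plain conjugation. *)
Lemma reflect_circle (F : R[i] -> R[i]) x : reflect_c F x%:v = (F x%:v)^*.
Proof.
congr (F _)^*; have h := circle_conjM x.
have c0 : (x%:v)^* != 0 by rewrite conjC_eq0 circle_val_neq0.
by rewrite mul1r; apply: (mulfI c0); rewrite h divff.
Qed.

Lemma one_sub_neq0 (u v : R[i]) : `|u| < 1 -> `|v| <= 1 -> 1 - u^* * v != 0.
Proof.
move=> u1 v1; rewrite subr_eq0; apply/eqP => /(congr1 Num.norm).
rewrite normr1 normrM norm_conjC => /esym h.
suff : `|u| * `|v| < 1 by rewrite h ltxx.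
by rewrite (le_lt_trans _ u1)// ler_piMr.
Qed.

Lemma norm_circle x : `|x%:v| = 1.
Proof. by rewrite cmodE cmod_circle. Qed.

Lemma varpi_neq0 n x : varpi alpha n x%:v != 0.
Proof. by apply: one_sub_neq0; rewrite ?norm_circle. Qed.

Lemma varpi_star_conj n x : varpi_star alpha n x%:v = x%:v * (varpi alpha n x%:v)^*.
Proof.
rewrite /varpi_star /varpi rmorphB rmorphM/= rmorph1 conjCK mulrBr mulr1.
by rewrite mulrCA [x%:v * _]mulrC circle_conjM mulr1.
Qed.

(** On the circle [varpi^*] = z conj(varpi), so numerator and denominator have the same modulus. *)
Lemma zeta_conjM n x : (zeta alpha n x%:v)^* * zeta alpha n x%:v = 1.
Proof.
rewrite /zeta varpi_star_conj !rmorphM/= conjCK fmorphV/=.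
have := circle_conjM x; have := varpi_neq0 n x; set w := varpi _ _ _ => w0 h.
have w0' : w^* != 0 by rewrite conjC_eq0.
transitivity ((x%:v)^* * x%:v * (w / w) * (w^* / w^* )); first by ring.
by rewrite h !divff// !mul1r.
Qed.

Lemma cmod_unimod (u : R[i]) : u^* * u = 1 -> cmod u = 1.
Proof.
rewrite cmod_sqrE => /(@complexI R)/eqP.
rewrite sqrf_eq1 => /orP[/eqP//|/eqP h].
by have := cmod_ge0 u; rewrite h; lra.
Qed.

Lemma blaschkeS n z : blaschke alpha n.+1 z = blaschke alpha n z * zeta alpha n.+1 z.
Proof. by rewrite /blaschke big_nat_recr. Qed.

Lemma blaschke0 z : blaschke alpha 0 z = 1.
Proof. by rewrite /blaschke big_geq. Qed.

Lemma blaschke_evenS n z :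
  blaschke_even alpha n.+1 z = blaschke_even alpha n z * zeta alpha n.+1.*2 z.
Proof. by rewrite /blaschke_even big_nat_recr. Qed.

Lemma blaschke_even0 z : blaschke_even alpha 0 z = 1.
Proof. by rewrite /blaschke_even big_geq. Qed.

Lemma blaschke_conjM n x : (blaschke alpha n x%:v)^* * blaschke alpha n x%:v = 1.
Proof.
rewrite /blaschke rmorph_prod/= -big_split/= big1// => k _.
by rewrite zeta_conjM.
Qed.

Lemma blaschke_even_conjM n x :
  (blaschke_even alpha n x%:v)^* * blaschke_even alpha n x%:v = 1.
Proof.
rewrite /blaschke_even rmorph_prod/= -big_split/= big1// => k _.
by rewrite zeta_conjM.
Qed.

Lemma cmeas_zeta n : cmeas (fun x => zeta alpha n x%:v).
Proof.
apply: cmeasM; first by apply: cmeasB; [exact: cmeas_val|exact: cmeas_cst].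
apply: cmeasV; apply: cmeasB; first exact: cmeas_cst.
by apply: cmeasZ; exact: cmeas_val.
Qed.

Lemma cmeas_blaschke n : cmeas (fun x => blaschke alpha n x%:v).
Proof.
apply: (@cmeas_prod _ _ (fun k x => zeta alpha k x%:v)) => k.
exact: cmeas_zeta.
Qed.

Lemma cmeas_blaschke_even n : cmeas (fun x => blaschke_even alpha n x%:v).
Proof.
apply: (@cmeas_prod _ _ (fun k x => zeta alpha k.*2 x%:v)) => k.
exact: cmeas_zeta.
Qed.

Lemma L2_blaschke n : L2 mu (fun x => blaschke alpha n x%:v).
Proof.
apply: (@L2_bounded _ _ _ 1); first exact: cmeas_blaschke.
by move=> x; rewrite cmod_unimod// blaschke_conjM.
Qed.

Definition spanB n f : Prop := exists c : nat -> R[i],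
  forall x, f x = \sum_(k < n.+1) c k * blaschke alpha k x%:v.

Lemma spanB_le m n f : (m <= n)%N -> spanB m f -> spanB n f.
Proof.
move=> mn [c fc]; exists (fun k => if (k < m.+1)%N then c k else 0) => x.
rewrite fc (big_ord_widen n.+1 (fun k => c k * blaschke alpha k x%:v))//.
by rewrite big_mkcond/=; apply: eq_bigr => k _; case: ifP; rewrite ?mul0r.
Qed.

Lemma spanBD n f g : spanB n f -> spanB n g -> spanB n (fun x => f x + g x).
Proof.
move=> [c fc] [d gd]; exists (fun k => c k + d k) => x.
by rewrite fc gd -big_split/=; apply: eq_bigr => k _; rewrite mulrDl.
Qed.

Lemma spanBZ n c f : spanB n f -> spanB n (fun x => c * f x).
Proof.
move=> [d fd]; exists (fun k => c * d k) => x.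
by rewrite fd mulr_sumr; apply: eq_bigr => k _; rewrite mulrA.
Qed.

Lemma spanB_blaschke k n : (k <= n)%N -> spanB n (fun x => blaschke alpha k x%:v).
Proof.
move=> kn; apply: (spanB_le kn); exists (fun j => (j == k)%:R) => x.
rewrite big_ord_recr/= eqxx mul1r big1 ?add0r// => j _.
by rewrite ltn_eqF// mul0r.
Qed.

Lemma eq_spanB n f g : f =1 g -> spanB n f -> spanB n g.
Proof. by move=> /funext ->. Qed.

Lemma spanB_sum n m (f : nat -> circle R -> R[i]) :
  (forall k, (k < m)%N -> spanB n (f k)) -> spanB n (fun x => \sum_(k < m) f k x).
Proof.
elim: m => [|m IH] H.
  by exists (fun=> 0) => x; rewrite big_ord0 big1// => j _; rewrite mul0r.
apply: (@eq_spanB _ (fun x => \sum_(k < m) f k x + f m x)).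
  by move=> x; rewrite big_ord_recr.
by apply: spanBD; [apply: IH => k km; apply: H; rewrite ltnW|exact: H].
Qed.

(* [zeta n] and [zeta j] are Moebius functions, hence related by a bilinear
   identity. *)
Lemma zeta_bilinear n j x :
  (1 - (alpha n)^* * alpha j) * zeta alpha n x%:v =
  ((alpha n)^* - (alpha j)^* ) * (zeta alpha n x%:v * zeta alpha j x%:v)
  + (1 - alpha n * (alpha j)^* ) * zeta alpha j x%:v + (alpha j - alpha n).
Proof.
have := varpi_neq0 n x; have := varpi_neq0 j x; rewrite /zeta /varpi_star /varpi.
by move=> h1 h2; field; rewrite h1 h2.
Qed.

(** Descending induction on k, starting from zeta_n B_(n-1) = B_n. The bilinear identity with j = k
    + 1, multiplied by B_k, expresses zeta_n B_k through zeta_n B_(k+1), B_(k+1) and B_k; its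
    leading coefficient is nonzero in the disk. *)
Lemma spanB_zeta_blaschke n k : (k < n)%N ->
  spanB n (fun x => zeta alpha n x%:v * blaschke alpha k x%:v).
Proof.
move=> kn; have [d] := ubnPeq (n - k.+1)%N; elim: d k kn => [|d IH] k kn.
  rewrite subn_eq0 => nk; have -> : n = k.+1 by apply/eqP; rewrite eqn_leq nk kn.
  apply: (@eq_spanB _ (fun x => blaschke alpha k.+1 x%:v)); last exact: spanB_blaschke.
  by move=> x; rewrite blaschkeS mulrC.
move=> nk; have kn' : (k.+1 < n)%N by rewrite -subn_gt0 (eqP nk).
have b0 : 1 - (alpha n)^* * alpha k.+1 != 0 by apply: one_sub_neq0 => //; rewrite ltW.
apply: (@eq_spanB _ (fun x => (1 - (alpha n)^* * alpha k.+1)^-1 *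
  (((alpha n)^* - (alpha k.+1)^* ) * (zeta alpha n x%:v * blaschke alpha k.+1 x%:v) +
  ((1 - alpha n * (alpha k.+1)^* ) * blaschke alpha k.+1 x%:v +
  (alpha k.+1 - alpha n) * blaschke alpha k x%:v)))).
  move=> x; apply: (mulfI b0); rewrite mulVKf// [RHS]mulrA zeta_bilinear blaschkeS.
  ring.
apply: spanBZ; apply: spanBD; first by apply: spanBZ; apply: IH => //; rewrite subnS (eqP nk).
by apply: spanBD; apply: spanBZ; apply: spanB_blaschke => //; exact: ltnW.
Qed.

Lemma spanB_zeta m n f : (m < n)%N -> spanB m f ->
  spanB n (fun x => zeta alpha n x%:v * f x).
Proof.
move=> mn [c fc].
apply: (@eq_spanB _ (fun x => \sum_(k < m.+1) c k * (zeta alpha n x%:v * blaschke alpha k x%:v))).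
  by move=> x; rewrite fc mulr_sumr; apply: eq_bigr => k _; rewrite mulrCA.
apply: (@spanB_sum _ _ (fun k x => c k * (zeta alpha n x%:v * blaschke alpha k x%:v))).
move=> k km; apply: spanBZ; apply: spanB_zeta_blaschke.
by rewrite (leq_trans km).
Qed.

(** The product is zeta_(k+1) ... zeta_n; multiplying by the factors in increasing order raises the
    span by one index at each step. This puts [phi_star] in the span. *)
Lemma spanB_blaschke_conj k n : (k <= n)%N ->
  spanB n (fun x => blaschke alpha n x%:v * (blaschke alpha k x%:v)^* ).
Proof.
move=> kn; rewrite -(subnKC kn); elim: (n - k)%N => [|d IH].
  apply: (@eq_spanB _ (fun x => blaschke alpha 0 x%:v)); last exact: spanB_blaschke.
  by move=> x; rewrite addn0 mulrC blaschke_conjM blaschke0.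
rewrite addnS; apply: (@eq_spanB _ (fun x => zeta alpha (k + d).+1 x%:v *
    (blaschke alpha (k + d) x%:v * (blaschke alpha k x%:v)^* ))).
  by move=> x; rewrite blaschkeS; ring.
exact: spanB_zeta IH.
Qed.

Lemma phi_span n : exists c : nat -> R[i], forall z,
  phi n z = \sum_(k < n.+1) c k * blaschke alpha k z.
Proof. by have [/(_ n)[]] := phi_orf. Qed.

Lemma spanB_phi n : spanB n (fun x => phi n x%:v).
Proof. by have [c cP] := phi_span n; exists c => x. Qed.

Lemma phi_starE n x : phi_star alpha phi n x%:v = blaschke alpha n x%:v * (phi n x%:v)^*.
Proof. by rewrite /phi_star reflect_circle. Qed.

Lemma phi_conjE n x : (phi n x%:v)^* = (blaschke alpha n x%:v)^* * phi_star alpha phi n x%:v.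
Proof. by rewrite phi_starE mulrA blaschke_conjM mul1r. Qed.

Lemma spanB_phi_star n : spanB n (fun x => phi_star alpha phi n x%:v).
Proof.
have [c cP] := phi_span n.
apply: (@eq_spanB _ (fun x => \sum_(k < n.+1) (c k)^* *
  (blaschke alpha n x%:v * (blaschke alpha k x%:v)^* ))).
  move=> x; rewrite phi_starE cP rmorph_sum/= mulr_sumr.
  by apply: eq_bigr => k _; rewrite rmorphM/= mulrCA.
apply: (@spanB_sum _ _ (fun k x => (c k)^* * (blaschke alpha n x%:v * (blaschke alpha k x%:v)^* ))).
by move=> k kn; apply: spanBZ; exact: spanB_blaschke_conj.
Qed.

Lemma L2_spanB n f : spanB n f -> L2 mu f.
Proof.
move=> [c /funext ->].
apply: (@L2_sum _ _ n.+1 (fun k x => c k * blaschke alpha k x%:v)) => k.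
by apply: L2Z; exact: L2_blaschke.
Qed.

Lemma L2_phi n : L2 mu (fun x => phi n x%:v).
Proof. exact: L2_spanB (spanB_phi n). Qed.

Lemma phi_orth n m f : (m < n)%N -> spanB m f ->
  L2dot mu (fun x => phi n x%:v) f = 0.
Proof.
move=> mn [c /funext ->].
rewrite (@L2dot_sum _ _ _ _ c (fun k x => blaschke alpha k x%:v));
  [|exact: L2_phi|exact: L2_blaschke].
rewrite big1// => k _; have [sp on _ _ _] := phi_orf.
have [_ [d dP]] := sp k.
have -> : L2dot mu (fun x => phi n x%:v) (fun x => blaschke alpha k x%:v) =
    L2dot mu (fun x => phi n x%:v) (fun x => \sum_(j < k.+1) d j * phi j x%:v).
  by apply: eq_L2dot => // x; exact: dP.
rewrite (@L2dot_sum _ _ _ _ d (fun k x => phi k x%:v)); [|exact: L2_phi|exact: L2_phi].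
rewrite big1 ?mulr0// => j _; have /= -> := on n j.
rewrite gtn_eqF ?mulr0//; apply: leq_ltn_trans mn.
by rewrite -ltnS (leq_trans (ltn_ord j)).
Qed.

(** The cofactor of [blaschke_even] in B_2n; conjugating [chi] replaces the even product by this
    one. *)
Definition blaschke_odd n z : R[i] := \prod_(1 <= k < n.+1) zeta alpha k.*2.-1 z.

Lemma blaschke_oddS n z :
  blaschke_odd n.+1 z = blaschke_odd n z * zeta alpha n.*2.+1 z.
Proof. by rewrite /blaschke_odd big_nat_recr. Qed.

Lemma blaschke_odd_conjM n x : (blaschke_odd n x%:v)^* * blaschke_odd n x%:v = 1.
Proof.
rewrite /blaschke_odd rmorph_prod/= -big_split/= big1// => k _.
by rewrite zeta_conjM.
Qed.

Lemma blaschke_split n z :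
  blaschke alpha n.*2 z = blaschke_odd n z * blaschke_even alpha n z.
Proof.
elim: n => [|n IH].
  by rewrite blaschke0 blaschke_even0 /blaschke_odd big_geq// mulr1.
by rewrite doubleS !blaschkeS IH blaschke_oddS blaschke_evenS doubleS; ring.
Qed.

(** The quotient of the even products is zeta_(2j+2) ... zeta_2k. Taken in increasing order, each
    factor has an index above the span reached so far, as [spanB_zeta] requires. *)
Lemma spanB_even_chain j k m f : (j < k)%N -> (m <= j.*2.+1)%N -> spanB m f ->
  spanB k.*2 (fun x => blaschke_even alpha k x%:v * (blaschke_even alpha j x%:v)^* * f x).
Proof.
move=> jk mj fm; rewrite -(subnKC jk); elim: (k - j.+1)%N => [|d IH].
  rewrite addn0; apply: (@eq_spanB _ (fun x => zeta alpha (j.+1).*2 x%:v * f x)).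
    move=> x; rewrite blaschke_evenS; have := blaschke_even_conjM j x.
    set b := blaschke_even _ _ _ => h.
    by rewrite -[LHS]mul1r -h; ring.
  by apply: spanB_zeta fm.
rewrite addnS; apply: (@eq_spanB _ (fun x => zeta alpha (j.+1 + d).+1.*2 x%:v *
  (blaschke_even alpha (j.+1 + d) x%:v * (blaschke_even alpha j x%:v)^* * f x))).
  by move=> x; rewrite blaschke_evenS; ring.
by apply: spanB_zeta IH; rewrite doubleS.
Qed.

Lemma spanB_odd_chain j k m f : (j < k)%N -> (m <= j.*2)%N -> spanB m f ->
  spanB k.*2.-1 (fun x => blaschke_odd k x%:v * (blaschke_odd j x%:v)^* * f x).
Proof.
move=> jk mj fm; rewrite -(subnKC jk); elim: (k - j.+1)%N => [|d IH].
  rewrite addn0; apply: (@eq_spanB _ (fun x => zeta alpha j.*2.+1 x%:v * f x)).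
    move=> x; rewrite blaschke_oddS; have := blaschke_odd_conjM j x.
    set b := blaschke_odd _ _ => h.
    by rewrite -[LHS]mul1r -h; ring.
  by apply: spanB_zeta fm.
rewrite addnS; apply: (@eq_spanB _ (fun x => zeta alpha (j.+1 + d).*2.+1 x%:v *
  (blaschke_odd (j.+1 + d) x%:v * (blaschke_odd j x%:v)^* * f x))).
  by move=> x; rewrite blaschke_oddS; ring.
by apply: spanB_zeta IH; rewrite addSn doubleS.
Qed.

Lemma chiE n x : chi alpha phi n x = (blaschke_even alpha n./2 x%:v)^* *
  (if odd n then phi n x%:v else phi_star alpha phi n x%:v).
Proof. by rewrite /chi reflect_circle. Qed.

Lemma chi_even k x : chi alpha phi k.*2 x =
  (blaschke_even alpha k x%:v)^* * phi_star alpha phi k.*2 x%:v.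
Proof. by rewrite chiE odd_double doubleK. Qed.

Lemma chi_odd k x : chi alpha phi k.*2.+1 x =
  (blaschke_even alpha k x%:v)^* * phi k.*2.+1 x%:v.
Proof. by rewrite chiE/= odd_double uphalf_double. Qed.

Lemma cmod_blaschke_even n x : cmod (blaschke_even alpha n x%:v)^* = 1.
Proof. by rewrite cmod_conj cmod_unimod// blaschke_even_conjM. Qed.

Lemma L2_chi n : L2 mu (chi alpha phi n).
Proof.
have -> : chi alpha phi n = fun x => (blaschke_even alpha n./2 x%:v)^* *
    (if odd n then phi n x%:v else phi_star alpha phi n x%:v).
  by apply/funext => x; rewrite chiE.
apply: (@L2M _ _ _ _ 1).
- exact: cmeasJ (cmeas_blaschke_even _).
- by move=> x; rewrite cmod_blaschke_even.
- by case: (odd n); [exact: L2_phi|exact: L2_spanB (spanB_phi_star n)].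
Qed.

Lemma cmod_chi n x : cmod (chi alpha phi n x) = cmod (phi n x%:v).
Proof.
rewrite chiE cmodM cmod_blaschke_even mul1r; case: (odd n) => //.
by rewrite phi_starE cmodM cmod_unimod ?blaschke_conjM// mul1r cmod_conj.
Qed.

(** Moving the unimodular even product to the other side leaves [phi] of index 2k+1 against B^e_k
    chi_m, which lies in L_2k. *)
Lemma chi_orth_odd k m : (m < k.*2.+1)%N ->
  L2dot mu (chi alpha phi k.*2.+1) (chi alpha phi m) = 0.
Proof.
move=> mn.
have -> : L2dot mu (chi alpha phi k.*2.+1) (chi alpha phi m) =
    L2dot mu (fun x => phi k.*2.+1 x%:v) (fun x => blaschke_even alpha k x%:v * chi alpha phi m x).
  congr cintegral; apply/funext => x; rewrite chi_odd rmorphM/= conjCK.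
  by rewrite -mulrA mulrCA.
apply: (@phi_orth _ k.*2) => //.
have jk : (m./2 <= k)%N by rewrite -(doubleK k) half_leq.
have gm : spanB m (fun x => if odd m then phi m x%:v else phi_star alpha phi m x%:v).
  by case: (odd m); [exact: spanB_phi|exact: spanB_phi_star].
(* If the halves agree then m = 2k, and the even products cancel to leave [phi_star]. *)
move: jk; rewrite leq_eqVlt => /predU1P[jk|jk].
  apply: eq_spanB (spanB_le _ gm) => // x.
  by rewrite chiE jk mulrA [X in _ = X * _]mulrC blaschke_even_conjM mul1r.
have mj : (m <= (m./2).*2.+1)%N.
  by rewrite -{1}(odd_double_half m); case: (odd m).
apply: eq_spanB (spanB_even_chain jk mj gm) => x.
by rewrite chiE mulrA.
Qed.

Lemma chi_conj_even j x : (chi alpha phi j.*2 x)^* = (blaschke_odd j x%:v)^* * phi j.*2 x%:v.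
Proof.
rewrite chi_even rmorphM/= conjCK phi_starE rmorphM/= conjCK blaschke_split rmorphM/=.
have := blaschke_even_conjM j x; set b := blaschke_even _ _ _ => h.
by rewrite -[RHS]mul1r -h; ring.
Qed.

Lemma chi_conj_odd j x :
  (chi alpha phi j.*2.+1 x)^* = (blaschke_odd j.+1 x%:v)^* * phi_star alpha phi j.*2.+1 x%:v.
Proof.
rewrite chi_odd rmorphM/= conjCK phi_conjE blaschkeS blaschke_split blaschke_oddS !rmorphM/=.
have := blaschke_even_conjM j x; set b := blaschke_even _ _ _ => h.
by rewrite -[RHS]mul1r -h; ring.
Qed.

(** On the circle chi_2k = B^o_k conj(phi_2k). The product is therefore that of phi_2k with B^o_k
    conj(chi_m), which lies in L_(2k-1). *)
Lemma chi_orth_even k m : (m < k.*2)%N ->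
  L2dot mu (chi alpha phi m) (chi alpha phi k.*2) = 0.
Proof.
move=> mn.
have -> : L2dot mu (chi alpha phi m) (chi alpha phi k.*2) =
    L2dot mu (fun x => phi k.*2 x%:v) (fun x => blaschke_odd k x%:v * (chi alpha phi m x)^* ).
  congr cintegral; apply/funext => x; rewrite chi_even phi_starE blaschke_split.
  have := blaschke_even_conjM k x; set b := blaschke_even _ _ _ => h.
  by rewrite -[RHS]mul1r -h; ring.
suff H : spanB k.*2.-1 (fun x => blaschke_odd k x%:v * (chi alpha phi m x)^* ).
  by rewrite (phi_orth _ H)//; case: k mn {H}.
have jk : (m./2 < k)%N.
  by rewrite -ltn_double (leq_ltn_trans _ mn)// -[leqRHS](odd_double_half m) leq_addl.
have := odd_double_half m; case: (odd m) => mE; rewrite -mE ?add0n ?add1n.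
  (* Here m = 2j + 1 and conj(chi_m) carries B^o_(j+1): for j + 1 = k the odd products cancel,
     otherwise the chain starts from j + 1. *)
  move: jk; rewrite leq_eqVlt => /predU1P[jk|jk].
    rewrite -{1 2}jk; apply: eq_spanB (spanB_phi_star (m./2).*2.+1) => x.
    by rewrite chi_conj_odd mulrA [X in _ = X * _]mulrC blaschke_odd_conjM mul1r.
  apply: eq_spanB (spanB_odd_chain jk _ (spanB_phi_star (m./2).*2.+1)); last by rewrite doubleS.
  by move=> x; rewrite chi_conj_odd [RHS]mulrA.
apply: eq_spanB (spanB_odd_chain jk (leqnn _) (spanB_phi (m./2).*2)) => x.
by rewrite chi_conj_even mulrA.
Qed.

Lemma chi_orth_lt m n : (m < n)%N -> L2dot mu (chi alpha phi n) (chi alpha phi m) = 0.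
Proof.
elim/even_odd_ind: n => k mn; last exact: chi_orth_odd.
by rewrite -(L2dotJ (L2_chi m) (L2_chi k.*2)) chi_orth_even// conjC0.
Qed.

Lemma chi_orthonormal : Defs.orthonormal (L2dot mu) (chi alpha phi).
Proof.
move=> i j; have [ij|ij|->] := ltngtP i j.
- by rewrite -(L2dotJ (L2_chi j) (L2_chi i)) chi_orth_lt// conjC0.
- exact: chi_orth_lt.
- rewrite L2dot_sqL; have [_ on _ _ _] := phi_orf.
  have := on j j; rewrite eqxx L2dot_sqL => <-; congr (_%:C%C).
  by apply: eq_Rintegral => x _; rewrite cmod_chi.
Qed.

Lemma chi0 x : chi alpha phi 0 x = 1.
Proof.
have [_ _ phi0 _ _] := phi_orf.
by rewrite chiE/= blaschke_even0 phi_starE blaschke0 phi0 !conjC1 !mulr1.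
Qed.

End ORFAlgebra.

(** * The recurrence in matrix form *)

Section Recurrence.
Context {R : realType} (mu : probability (circle_borel R) R).
Context (alpha a : nat -> R[i]) (phi : nat -> R[i] -> R[i]) (r : R).
Hypothesis alpha_r : forall n, cmod (alpha n) <= r.
Hypothesis r1 : r < 1.
Hypothesis phi_orf : is_orf mu alpha phi a.

Local Notation "x %:v" := (circle_val x) (at level 2, format "x %:v").
Local Notation chi := (chi alpha phi).
Local Notation eta := (eta alpha).
Implicit Types (x : circle R) (y : nat -> R[i]).

Let alpha1 n : `|alpha n| < 1.
Proof. by rewrite cmodE ltcR (le_lt_trans (alpha_r n)). Qed.

Let a1 n : (0 < n)%N -> `|a n| < 1.
Proof. by have [_ _ _ + _] := phi_orf; apply. Qed.

Let rho_neq0 n : rho a n.+1 != 0.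
Proof. by rewrite gt_eqF// rho_gt0. Qed.

(** varpi_n(alpha_n) = eta_n^2, and the right-hand side is nonnegative, so the square root can be
    taken. *)
Lemma orf_eE n : orf_e alpha a n.+1 = eta n.+1 / (eta n * rho a n.+1).
Proof.
have pos : 0 <= eta n.+1 / (eta n * rho a n.+1).
  have e0 k : 0 <= eta k by apply/ltW/(eta_gt0 alpha_r).
  by rewrite divr_ge0// mulr_ge0//; apply/ltW/(rho_gt0 a1).
rewrite -[RHS]sqrCK// /orf_e; congr sqrtC.
have E k : varpi alpha k (alpha k) = eta k * eta k.
  by rewrite (eta_sqr alpha_r r1) /varpi [_ * alpha k]mulrC.
rewrite /= !E -rho_sqr//; have := eta_neq0 alpha_r r1 n; have := rho_neq0 n.
by move: (eta n) (eta n.+1) (rho a n.+1) => e e' p p0 e0; field; rewrite p0 e0.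
Qed.

(** From transfer to scattering form, with p, ps the functions of index n and P, Ps those of index n
    + 1: the first relation is solved for p and the result substituted in the second. The condition
    q^2 = 1 - bc makes the coefficients those of [Theta]. *)
Lemma recurrence_algebra (p ps P Ps w w' ws e e' q b c : R[i]) :
  w != 0 -> w' != 0 -> e != 0 -> e' != 0 -> q != 0 -> q * q = 1 - b * c ->
  P = e' / (e * q) * (w / w') * (ws / w * p + b * ps) ->
  Ps = e' / (e * q) * (w / w') * (c * (ws / w * p) + ps) ->
  ws * p / e = - b * (w * ps / e) + q * (w' * P / e') /\
  w' * Ps / e' = q * (w * ps / e) + c * (w' * P / e').
Proof.
move=> w0 w'0 e0 e'0 q0 qq -> ->; split; first by field; rewrite w0 w'0 e0 e'0 q0.
apply/eqP; rewrite -subr_eq0; apply/eqP.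
transitivity (w * ps / (e * q) * (1 - b * c - q * q)).
  by field; rewrite w0 w'0 e0 e'0 q0.
by rewrite qq subrr mulr0.
Qed.

Lemma orf_recurrence n x : let z := x%:v in
  varpi_star alpha n z * phi n z / eta n =
    - a n.+1 * (varpi alpha n z * phi_star alpha phi n z / eta n) +
    rho a n.+1 * (varpi alpha n.+1 z * phi n.+1 z / eta n.+1) /\
  varpi alpha n.+1 z * phi_star alpha phi n.+1 z / eta n.+1 =
    rho a n.+1 * (varpi alpha n z * phi_star alpha phi n z / eta n) +
    (a n.+1)^* * (varpi alpha n.+1 z * phi n.+1 z / eta n.+1).
Proof.
move=> z; have [_ _ _ _ /(_ n.+1 x erefl)[E1 E2]] := phi_orf.
rewrite orf_eE/= in E1 E2; apply: recurrence_algebra E1 E2.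
- exact: varpi_neq0.
- exact: varpi_neq0.
- exact: eta_neq0 alpha_r r1 _.
- exact: eta_neq0 alpha_r r1 _.
- exact: rho_neq0.
- by rewrite -expr2 rho_sqr// normCK.
Qed.

(* In terms of these sequences the recurrence reads [(Y_2k, Y_2k+1) =
   Theta_{2k+1} (w_2k, w_2k+1)] and [(ws_2k-1, ws_2k) = Theta_{2k} (Y_2k-1, Y_2k)]. *)
Let w x i := varpi alpha i x%:v * chi i x / eta i.
Let ws x i := varpi_star alpha i x%:v * chi i x / eta i.
Let Y x i := (blaschke_even alpha i./2 x%:v)^* *
  ((if odd i then varpi alpha i x%:v * phi_star alpha phi i x%:v
    else varpi_star alpha i x%:v * phi i x%:v) / eta i).

Lemma odd_step x k :
  Y x k.*2 = blk (fun k => Theta a k.*2.+1) (w x) k.*2 /\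
  Y x k.*2.+1 = blk (fun k => Theta a k.*2.+1) (w x) k.*2.+1.
Proof.
rewrite blk_even blk_odd; have [-> [-> [-> ->]]] := ThetaE a k.*2.+1.
have [E1 E2] := orf_recurrence k.*2 x.
rewrite /Y /w chi_even chi_odd /= odd_double doubleK uphalf_double /=.
by split; rewrite ?E1 ?E2; ring.
Qed.

(** Between 2k+1 and 2k+2 the even product gains a factor. On the circle the conjugate of
    zeta_(2k+2) turns [varpi^*] into [varpi], so after this exchange all four terms share the factor
    conj(B^e_k) and the recurrence applies. *)
Lemma even_step x k :
  ws x k.*2.+1 = blk (fun k => Theta a k.*2.+2) (fun i => Y x i.+1) k.*2 /\
  ws x k.*2.+2 = blk (fun k => Theta a k.*2.+2) (fun i => Y x i.+1) k.*2.+1.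
Proof.
rewrite blk_even blk_odd; have [-> [-> [-> ->]]] := ThetaE a k.*2.+2.
have [E1 E2] := orf_recurrence k.*2.+1 x.
have bE : (blaschke_even alpha k.+1 x%:v)^* * varpi_star alpha k.*2.+2 x%:v =
    (blaschke_even alpha k x%:v)^* * varpi alpha k.*2.+2 x%:v.
  rewrite blaschke_evenS rmorphM/= -mulrA; congr (_ * _).
  have := zeta_conjM alpha1 k.*2.+2 x; rewrite {2}/zeta doubleS => h.
  have v0 := varpi_neq0 alpha1 k.*2.+2 x.
  by apply: (mulIf (invr_neq0 v0)); rewrite -mulrA h divff.
have bE' p e : (blaschke_even alpha k x%:v)^* * (varpi alpha k.*2.+2 x%:v * p / e) =
    (blaschke_even alpha k.+1 x%:v)^* * (varpi_star alpha k.*2.+2 x%:v * p / e).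
  by rewrite !mulrA -bE.
have -> : ws x k.*2.+2 = (blaschke_even alpha k x%:v)^* *
    (varpi alpha k.*2.+2 x%:v * phi_star alpha phi k.*2.+2 x%:v / eta k.*2.+2).
  by rewrite bE' /ws -doubleS chi_even; ring.
have YE : Y x k.*2.+2 = (blaschke_even alpha k x%:v)^* *
    (varpi alpha k.*2.+2 x%:v * phi k.*2.+2 x%:v / eta k.*2.+2).
  by rewrite bE' /Y /= odd_double doubleK.
have YO : Y x k.*2.+1 = (blaschke_even alpha k x%:v)^* *
    (varpi alpha k.*2.+1 x%:v * phi_star alpha phi k.*2.+1 x%:v / eta k.*2.+1).
  by rewrite /Y /= odd_double uphalf_double.
rewrite YE YO /ws chi_odd; split; last by rewrite E2; ring.
transitivity ((blaschke_even alpha k x%:v)^* *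
  (varpi_star alpha k.*2.+1 x%:v * phi k.*2.+1 x%:v / eta k.*2.+1)); first by ring.
by rewrite E1; ring.
Qed.

Lemma ws0 x : ws x 0 = Y x 0.
Proof.
have [_ _ phi0 _ _] := phi_orf.
by rewrite /ws /Y/= (chi0 phi_orf) blaschke_even0 phi0 conjC1 mul1r.
Qed.

(** Both sides equal the sum of Y_i (C_e y)_i. The pairs of [C_o] fill the range 0..2N+1 exactly,
    whereas those of [C_e] overlap its end; this fixes the support condition on y. *)
Lemma sum_cmv x y N : (forall k, (N.*2 < k)%N -> y k = 0) ->
  \sum_(i < N.+1.*2) ws x i * y i = \sum_(i < N.+1.*2) w x i * cmv_seq a y i.
Proof.
move=> y0.
rewrite /cmv_seq /cmv_odd -(@sum_blk_sym _ _ _ (Y x)); first last.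
- by move=> k _; exact: odd_step.
- by move=> k; have [_ [-> [-> _]]] := ThetaE a k.*2.+1.
rewrite doubleS big_ord_recl [RHS]big_ord_recl ws0 /cmv_even /=; congr (_ + _).
(* The block of [C_e] that straddles the end acts on entries 2N+1 and 2N+2 of y, both zero. *)
have e0 : blk (fun k => Theta a k.*2.+2) (fun k => y k.+1) N.*2 = 0.
  by rewrite blk_even !y0// ?mulr0 ?addr0//.
rewrite !big_ord_recr/= /bump/= !add1n y0// e0 !mulr0 !addr0.
apply: (@sum_blk_sym _ _ (fun i => Y x i.+1) (fun i => ws x i.+1) (fun i => y i.+1)).
- by move=> k; have [_ [-> [-> _]]] := ThetaE a k.*2.+2.
- by move=> k _; exact: even_step.
Qed.

(* [1 + A^dag C] and [C + A]. *)
Definition op_S y i : R[i] := y i + (alpha i)^* * cmv_seq a y i.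
Definition op_D y i : R[i] := cmv_seq a y i + alpha i * y i.

(* This is [z chi eta^-1 (1 + A^dag C) = chi eta^-1 (C + A)], for the row
   [chi] and applied to a finitely supported column [y]. *)
Lemma combo_val x y N : (forall k, (N.*2 < k)%N -> y k = 0) ->
  x%:v * combo chi N.+1.*2 (fun i => (eta i)^-1 * op_S y i) x =
  combo chi N.+1.*2 (fun i => (eta i)^-1 * op_D y i) x.
Proof.
move=> y0; have := sum_cmv x y0; rewrite /combo mulr_sumr => /eqP.
rewrite -subr_eq0 -sumrB => /eqP h; apply/eqP; rewrite -subr_eq0 -sumrB; apply/eqP.
by rewrite -[RHS]h; apply: eq_bigr => i _; rewrite /op_S /op_D /w /ws /varpi /varpi_star; ring.
Qed.

End Recurrence.

(** * Passage to the limit *)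

Section Truncation.
Context {R : realType}.
Implicit Types (y : nat -> R[i]) (T : (nat -> R[i]) -> nat -> R[i]).

Lemma local_pad T i : local T -> exists n (m : nat -> R[i]), forall k, (n <= k)%N ->
  forall y, T y i = \sum_(j < k) m j * y j.
Proof.
move=> /(_ i)[n [m E]]; exists n, (fun j => if (j < n)%N then m j else 0) => k nk y.
rewrite E (big_ord_widen k (fun j => m j * y j) nk) big_mkcond/=.
by apply: eq_bigr => j _; case: ifP; rewrite ?mul0r.
Qed.

Lemma lop_id : lop (@id (nat -> R[i])) 1.
Proof.
split => // [i|y M yM]; last by rewrite mul1r.
exists i.+1, (fun j => (j == i)%:R) => y.
rewrite big_ord_recr/= eqxx mul1r big1 ?add0r// => j _.
by rewrite ltn_eqF// mul0r.
Qed.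

Lemma lop_add (S T : (nat -> R[i]) -> nat -> R[i]) c d : lop S c -> lop T d ->
  lop (fun y i => S y i + T y i) (2 * (c + d)).
Proof.
move=> [c0 lS bS] [d0 lT bT]; split; first by rewrite mulr_ge0 ?addr_ge0.
- move=> i; have [n [m E]] := local_pad i lS; have [n' [m' E']] := local_pad i lT.
  exists (maxn n n'), (fun j => m j + m' j) => y.
  rewrite (E _ (leq_maxl n n')) (E' _ (leq_maxr n n')) -big_split/=.
  by apply: eq_bigr => j _; rewrite mulrDl.
- move=> y M yM N; apply: (@le_trans _ _ (\sum_(k < N)
    2 * (cmod (S y k) ^+ 2 + cmod (T y k) ^+ 2))).
    by apply: ler_sum => k _; exact: cmod_sqrD2.
  by rewrite -mulr_sumr big_split/= -mulrA ler_pM2l// mulrDl lerD// ?bS ?bT.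
Qed.

Definition trunc N y k : R[i] := if (k <= N)%N then y k else 0.

Lemma local_trunc T i y : local T ->
  exists n, forall N, (n <= N)%N -> T (trunc N y) i = T y i.
Proof.
move=> /(_ i)[n [m E]]; exists n => N nN; rewrite !E.
by apply: eq_bigr => j _; rewrite /trunc ifT// (leq_trans (ltnW (ltn_ord j))).
Qed.

Lemma trunc_l2b (b : ell2 R) e : 0 < e -> exists n, forall N, (n <= N)%N ->
  l2b (fun k => b k - trunc N b k) e.
Proof.
move=> e0; have [n nP] := sqn_tail b e0; exists n => N nN M.
have z k : (k <= N)%N -> cmod (b k - trunc N b k) ^+ 2 = 0.
  by move=> kN; rewrite /trunc kN subrr cmod0 expr0n.
have [MN|NM] := leqP M N.
  by rewrite big1 ?ltW// => k _; rewrite z// (leq_trans (ltnW (ltn_ord k))).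
rewrite -(big_mkord xpredT (fun k => cmod (b k - trunc N b k) ^+ 2)).
rewrite (@big_cat_nat _ _ _ N.+1)//= big_nat big1 ?add0r => [|k /andP[_ kN]]; last exact: z.
apply: le_trans (nP N.+1 M _); last exact: leq_trans nN _.
rewrite le_eqVlt; apply/orP; left; apply/eqP; apply: eq_big_nat => k /andP[Nk _].
by rewrite /trunc leqNgt Nk/= subr0.
Qed.

End Truncation.

Section Approximation.
Context {R : realType} (mu : probability (circle_borel R) R).
Context (chi : nat -> circle R -> R[i]).
Hypothesis L2chi : forall k, L2 mu (chi k).
Hypothesis chi_on : Defs.orthonormal (L2dot mu) chi.

Lemma combo_delta n (c : nat -> R[i]) j z : (j < n)%N ->
  chi j z - combo chi n c z = combo chi n (fun i => (i == j)%:R - c i) z.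
Proof.
move=> jn; rewrite /combo.
have -> : chi j z = \sum_(i < n) (i == j :> nat)%:R * chi i z.
  rewrite (bigD1 (Ordinal jn))//= eqxx mul1r big1 ?addr0// => i.
  by rewrite -val_eqE/= => /negbTE ->; rewrite mul0r.
by rewrite -sumrB; apply: eq_bigr => i _; rewrite mulrBl.
Qed.

(** The coefficients of the error are [T (x - trunc x)], and boundedness of [T] makes them as small
    as the tail of x; orthonormality transfers this to L^2. *)
Lemma combo_approx T c (x : ell2 R) j e : lop T c ->
  (forall i, T x i = (i == j)%:R) -> 0 < e ->
  exists n, forall N, (n <= N)%N ->
    sqL mu (fun z => chi j z - combo chi N.+1.*2 (T (trunc N.*2 x)) z) < e.
Proof.
move=> lT Tx e0; have c0 : 0 < c + 1 by rewrite ltr_wpDl// (lop_ge0 lT).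
have [n nP] := trunc_l2b x (divr_gt0 e0 c0).
exists (maxn n j) => N; rewrite geq_max => /andP[nN jN].
have jN2 : (j < N.+1.*2)%N.
  by rewrite doubleS ltnS ltnW// ltnS (leq_trans jN)// -addnn leq_addr.
rewrite (_ : (fun _ => _) = combo chi N.+1.*2 (T (fun k => x k - trunc N.*2 x k))).
  rewrite sqL_combo//.
  have := lop_bound lT (nP N.*2 (leq_trans nN _)).
  rewrite -{1}addnn leq_addr => /(_ isT N.+1.*2) h.
  apply: (le_lt_trans h); rewrite mulrA ltr_pdivrMr//.
  by rewrite mulrC ltr_pM2l// ltrDl.
apply/funext => z; rewrite combo_delta//; congr combo; apply/funext => i.
by rewrite (local_sub (lop_local lT)) Tx.
Qed.

End Approximation.

Section MainProof.
Context {R : realType} (mu : probability (circle_borel R) R).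
Context (alpha a : nat -> R[i]) (phi : nat -> R[i] -> R[i]) (r : R).
Hypothesis alpha_r : forall n, cmod (alpha n) <= r.
Hypothesis r1 : r < 1.
Hypothesis phi_orf : is_orf mu alpha phi a.

Local Notation chi := (chi alpha phi).
Local Notation eta := (eta alpha).

Let alpha1 n : `|alpha n| < 1.
Proof. by rewrite cmodE ltcR (le_lt_trans (alpha_r n)). Qed.

Let a1 n : (0 < n)%N -> `|a n| < 1.
Proof. by have [_ _ _ + _] := phi_orf; apply. Qed.

Let L2chi k : L2 mu (chi k).
Proof. exact: L2_chi alpha1 phi_orf k. Qed.

Let chi_on : Defs.orthonormal (L2dot mu) chi.
Proof. exact: chi_orthonormal alpha1 phi_orf. Qed.

Let r0 : 0 <= r := le_trans (cmod_ge0 (alpha 0)) (alpha_r 0).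

Definition etaV_op (T : (nat -> R[i]) -> nat -> R[i]) (y : nat -> R[i]) i : R[i] :=
  (eta i)^-1 * T y i.

Lemma lop_etaV_op T c : lop T c -> lop (etaV_op T) ((1 - r ^+ 2)^-1 * c).
Proof.
move=> lT; apply: (@lop_comp _ (dg (fun i => (eta i)^-1)) T) => //.
apply: lop_dg; last exact: etaV_le alpha_r r1.
by rewrite invr_ge0 subr_ge0 expr_le1// ltW.
Qed.

Lemma lop_op_S : exists c, lop (etaV_op (op_S alpha a)) c.
Proof.
eexists; apply: lop_etaV_op; apply: (lop_add lop_id).
apply: (@lop_comp _ (dg (aconj alpha)) _ (r ^+ 2) 1).
- apply: lop_dg => [|n]; first exact: sqr_ge0.
  by rewrite cmod_conj (alpha_sqr_le alpha_r).
- exact: lop_cmv.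
Qed.

Lemma lop_op_D : exists c, lop (etaV_op (op_D alpha a)) c.
Proof.
eexists; apply: lop_etaV_op; apply: lop_add; first exact: lop_cmv.
apply: (@lop_dg _ alpha (r ^+ 2)) => [|n]; first exact: sqr_ge0.
exact: alpha_sqr_le alpha_r _.
Qed.

Let chiN N T x z := combo chi N.+1.*2 (etaV_op T (trunc N.*2 x)) z.

Let chiN_val N x z :
  circle_val z * chiN N (op_S alpha a) x z = chiN N (op_D alpha a) x z.
Proof.
have y0 k : (N.*2 < k)%N -> trunc N.*2 x k = 0 by move=> Nk; rewrite /trunc leqNgt Nk.
exact (combo_val alpha_r r1 phi_orf z y0).
Qed.

Let L2chiN N T x : L2 mu (chiN N T x).
Proof. exact: L2_combo. Qed.

(** The combinations with coefficients eta^-1 S (trunc x) approach chi_j; multiplication by z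
    preserves the error and turns S into D by [combo_val]. *)
Lemma mul_z_approx (x : ell2 R) j e :
  (forall i, op_S alpha a x i = eta i * (i == j)%:R) -> 0 < e ->
  exists n, forall N, (n <= N)%N ->
    sqL mu (fun z => mul_z (chi j) z - chiN N (op_D alpha a) x z) < e.
Proof.
move=> xj e0; have [c lS] := lop_op_S.
have [|n nP] := combo_approx L2chi chi_on lS _ e0 (x := x) (j := j).
  by move=> i; rewrite /etaV_op xj mulKf// (eta_neq0 alpha_r r1).
exists n => N /nP; apply: le_lt_trans.
rewrite (_ : (fun z => mul_z _ z - _) = fun z => circle_val z *
    (chi j z - chiN N (op_S alpha a) x z)).
  rewrite -[leRHS]mul1r -[X in X * _](expr1n _ 2); apply: sqLM => //.
  - exact: cmeas_val.
  - by move=> z; rewrite cmod_circle.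
  - exact: L2B.
by apply/funext => z; rewrite mulrBr chiN_val.
Qed.

Lemma mul_zconj_approx (x : ell2 R) j e :
  (forall i, op_D alpha a x i = eta i * (i == j)%:R) -> 0 < e ->
  exists n, forall N, (n <= N)%N ->
    sqL mu (fun z => (circle_val z)^* * chi j z - chiN N (op_S alpha a) x z) < e.
Proof.
move=> xj e0; have [c lD] := lop_op_D.
have [|n nP] := combo_approx L2chi chi_on lD _ e0 (x := x) (j := j).
  by move=> i; rewrite /etaV_op xj mulKf// (eta_neq0 alpha_r r1).
exists n => N /nP; apply: le_lt_trans.
rewrite (_ : (fun z => _ * chi j z - _) = fun z => (circle_val z)^* *
    (chi j z - chiN N (op_D alpha a) x z)).
  rewrite -[leRHS]mul1r -[X in X * _](expr1n _ 2); apply: sqLM => //.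
  - exact: cmeasJ (@cmeas_val R).
  - by move=> z; rewrite cmod_conj cmod_circle.
  - exact: L2B.
by apply/funext => z; rewrite mulrBr; congr (_ - _); rewrite -chiN_val [RHS]mulrA circle_conjM mul1r.
Qed.

(** The right-hand side eta e_j as an element of [ell2]; its coordinates reduce to the form expected
    by the approximation lemmas. *)
Let delta j : ell2 R := ell2_op (lop_dg ler01 (eta_le1 alpha_r r1)) (l2unit j).

Lemma chi_closed_val j : in_closure mu chi (fun z => circle_val z * chi j z).
Proof.
split; first by apply: (L2M (@cmeas_val R) _ (L2chi j) (c := 1)) => z; rewrite cmod_circle.
move=> e e0; have [x xP] := moebius_solve a1 alpha_r r1 (delta j).
have [n /(_ n (leqnn n)) nP] := mul_z_approx xP e0.
by exists n.+1.*2, (etaV_op (op_D alpha a) (trunc n.*2 x)).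
Qed.

Lemma chi_closed_conj j : in_closure mu chi (fun z => (circle_val z)^* * chi j z).
Proof.
split.
  apply: (L2M (cmeasJ (@cmeas_val R)) _ (L2chi j) (c := 1)) => z.
  by rewrite cmod_conj cmod_circle.
move=> e e0; have [x xP] := moebius_solve' a1 alpha_r r1 (delta j).
have [n /(_ n (leqnn n)) nP] := mul_zconj_approx xP e0.
by exists n.+1.*2, (etaV_op (op_S alpha a) (trunc n.*2 x)).
Qed.

Lemma chi_basis : is_L2_basis mu chi.
Proof.
split => // g Lg e e0.
have one : in_closure mu chi (fun=> 1).
  rewrite (_ : (fun=> 1) = chi 0); first exact: in_closure_chi.
  by apply/funext => z; rewrite (chi0 phi_orf).
(* The closure is measured by squared norms, hence the tolerance e^2. *)
have [_ /(_ _ (exprn_gt0 2 e0))[n [c h]]] :=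
  closure_L2 L2chi chi_closed_val chi_closed_conj one Lg.
exists n, c; rewrite L2normE -(ger0_norm (ltW e0)) -sqrtr_sqr ltr_sqrt//.
exact: exprn_gt0.
Qed.

(** The i-th coefficient of the finite approximation is exactly the claimed value for large N, and
    Bessel's inequality bounds its distance to the matrix entry by the L^2 error, which is
    arbitrary. *)
Lemma mul_z_matrix (x : ell2 R) i j :
  (forall i, op_S alpha a x i = eta i * (i == j)%:R) ->
  op_matrix (L2dot mu) chi (@mul_z R) i j = (eta i)^-1 * op_D alpha a x i.
Proof.
move=> xP; apply/eqP; rewrite -subr_eq0; apply/eqP/cmod_sqr_eq0.
apply/eqP; rewrite eq_le sqr_ge0 andbT; apply/ler_addgt0Pl => e e0; rewrite addr0.
have [n nP] := mul_z_approx xP e0.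
have [c lD] := lop_op_D; have [m mP] := local_trunc i x (lop_local lD).
(* Large enough for the error e, for row i of D to see no truncation, and for index i to occur in
   the combination. *)
pose N := maxn (maxn n m) i.
have iN : (i < N.+1.*2)%N.
  rewrite doubleS ltnS ltnW// ltnS -addnn.
  by rewrite (leq_trans (leq_maxr (maxn n m) i))// leq_addr.
have nN : (n <= N)%N by rewrite (leq_trans (leq_maxl n m))// leq_maxl.
have mN : (m <= N.*2)%N.
  by rewrite -addnn (leq_trans _ (leq_addr _ _))// (leq_trans (leq_maxr n m))// leq_maxl.
apply: le_trans (ltW (nP N nN)).
have Lz : L2 mu (mul_z (chi j)).
  by apply: (L2M (@cmeas_val R) _ (L2chi j) (c := 1)) => z; rewrite cmod_circle.
have chi1 : sqL mu (chi i) = 1.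
  by apply: (@complexI R); rewrite -L2dot_sqL chi_on eqxx.
apply: le_trans (L2dot_bound (L2chi i) (L2B Lz (L2chiN N (op_D alpha a) x)) chi1).
rewrite le_eqVlt; apply/orP; left; apply/eqP; congr (cmod _ ^+ 2).
rewrite (_ : (fun z => _ - _) = fun z => mul_z (chi j) z + (-1) * chiN N (op_D alpha a) x z).
  rewrite L2dotD//; last exact: L2Z.
  rewrite L2dotZ// mulN1r /chiN (L2dot_combo L2chi chi_on)//.
  by rewrite (mP _ mN).
by apply/funext => z; rewrite mulN1r.
Qed.

Lemma moebius_matrix : exists A C U : ell2 R -> ell2 R,
    [/\ is_operator_of (mx_diag alpha) A,
        is_operator_of (cmv a) C,
        is_moebius l2dot A C U &
        is_operator_of (op_matrix (L2dot mu) chi (@mul_z R)) U].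
Proof.
have [A [C [U [AP CP UP bU UM]]]] := moebius_exists a1 alpha_r r1.
exists A, C, U; split => //; split => //.
apply/funext => i; apply/funext => j; rewrite {1}/op_matrix l2dot_unit.
by have [x [xP ->]] := UM j; rewrite (mul_z_matrix i xP).
Qed.

End MainProof.

Theorem theorem5p1 (R : realType) (mu : probability (circle_borel R) R)
    (alpha a : nat -> R[i]) (phi : nat -> R[i] -> R[i])
    (mu_inf : infinite_set (supp mu))
    (alpha0 : alpha 0%N = 0)
    (alpha_disk : forall n, (0 < n)%N -> `|alpha n| < 1)
    (alpha_cpt :
      (ereal_sup [set (cmod (alpha n))%:E | n in [set n | (0 < n)%N]] < 1)%E)
    (phi_orf : is_orf mu alpha phi a) :
  is_L2_basis mu (chi alpha phi) /\
  exists A C U : ell2 R -> ell2 R,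
    [/\ is_operator_of (mx_diag alpha) A,
        is_operator_of (cmv a) C,
        is_moebius l2dot A C U &
        is_operator_of (op_matrix (L2dot mu) (chi alpha phi) (@mul_z R)) U].
Proof.
(* The supremum runs over n > 0 and is finite, lying between |alpha_1| >= 0 and 1; as alpha_0 = 0,
   it also bounds the entry of index 0. *)
have [r r1 alpha_r] : exists2 r : R, r < 1 & forall n, cmod (alpha n) <= r.
  set s := ereal_sup _ in alpha_cpt.
  have le n : (0 < n)%N -> ((cmod (alpha n))%:E <= s)%E.
    by move=> n0; apply: ereal_sup_ubound; exists n.
  have s_fin : s \is a fin_num.
    rewrite fin_numElt (lt_trans alpha_cpt) ?ltry// andbT.
    by apply: lt_le_trans (le 1 isT); rewrite ltNyr.
  exists (fine s) => [|[|n]]; first by rewrite -lte_fin fineK.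
    rewrite alpha0 cmod0 -lee_fin fineK//; apply: le_trans (le 1 isT).
    by rewrite lee_fin cmod_ge0.
  by rewrite -lee_fin fineK// le.
split; first exact: chi_basis alpha_r r1 phi_orf.
exact: moebius_matrix alpha_r r1 phi_orf.
Qed.
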